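(* There exists an integer $N$ such that every integer $n \geq N$ can be written as $n = p + m$, where $p$ is a prime and $m$ is a positive integer that is not square-free.
   Context: A positive integer is square-free if it is not divisible by $q^2$ for any prime $q$; it is not square-free if $q^2$ divides it for some prime $q$. *)

(* Defs.v *)
From mathcomp Require Import all_boot.

Set Implicit Arguments.
Unset Strict Implicit.
Unset Printing Implicit Defensive.

(* Meant for m > 0; note that 0 is not square-free. *)
Definition squarefree (m : nat) : Prop :=
  forall q : nat, prime q -> ~~ (q ^ 2 %| m).

Lemma not_squarefreeP (m : nat) :
  0 < m -> ~ squarefree m <-> exists2 q, prime q & q ^ 2 %| m.
Proof.
move=> m_gt0; split=> [nsf | [q q_pr q2m] /(_ q q_pr)]; last by rewrite q2m.
have [/hasP[q] | /hasPn no_q] := boolP (has (fun q => q ^ 2 %| m) (primes m)).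
  by rewrite mem_primes => /andP[q_pr _] q2m; exists q.
case: nsf => q q_pr; apply/negP=> q2m.
have: q \in primes m.
  by rewrite mem_primes q_pr m_gt0 (dvdn_trans _ q2m) // expnS dvdn_mulr.
by move/no_q; rewrite q2m.
Qed.

(* Main.v *)
Require Import Defs.
From mathcomp Require Import all_boot all_order all_algebra.
From mathcomp Require Import reals exp Rstruct.
From mathcomp Require Import ring lra zify.

Set Implicit Arguments.
Unset Strict Implicit.
Unset Printing Implicit Defensive.
Import Order.TTheory GRing.Theory Num.Theory.
Local Open Scope ring_scope.

(** Suppose that n is large and that n - p is never divisible by the square of
    a prime, for p a prime below n. Then, for every prime q that does not
    divide n, the class of n modulo q ^ 2 is a reduced class without any prime
    below n. For a single q this is hard to refute, as q may have to be about
    log n; but it fails on average over the K primes q < T not dividing n,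
    where T is a small power of n, and the average can be treated by
    elementary means.

    Put f_q(m) = q(q-1) [m = n mod q^2] - [q does not divide m]. This function
    has period q^2 and mean zero. Let w be the sum of the f_q. Since the first
    half of f_q meets no prime and there are few proper prime powers, Chebyshev's
    lower bound gives (main_term_le)
      sum_(e < n) Lambda(e) w(e) <= - K n / 8.
    On the other hand, Vaughan's identity (vaughan) splits the left-hand side
    into sums of w over multiples of a small d, which are small because each
    f_q is periodic with mean zero (type_I_log_sum_le, type_I_small_le), and a
    bilinear sum of c(h) Lambda(e) w(eh) with both e and h large.

    The Cauchy-Schwarz inequality in h turns the bilinear sum into correlations
      sum_h h f_q(e h) f_q'(e' h).
    If q <> q', then the Chinese remainder theorem makes the mean of the
    summand vanish, and only a boundary term is left (ap_kernel_corr_le). Only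
    the K pairs with q = q' contribute, so that the square of the bilinear sum
    is O(K n^2 log(n)^7), where the trivial bound is K^2 n^2 up to logarithms
    (bilinear_le). Comparing with the main term yields K = O(log(n)^7), whereas
    Chebyshev's bound gives K >= T / (4 log(n)^2) - log(n). As T is a power of
    n, this is absurd. Since the gain is a power of n, no care is needed with
    powers of log n.

    Logarithms are taken in base 2, so that log T is a natural number when T is
    a power of two. They enter only through additivity, monotonicity and the
    values at 0 and 2, which are kept as hypotheses until the end. *)

(** * Periodic sums, partial summation and counting in residue classes *)

Lemma modn_mulI P d a b : coprime P d -> (d * a = d * b %[mod P])%N ->
  (a = b %[mod P])%N.
Proof.
move=> cop; wlog ab : a b / (a <= b)%N => [H|] E.
  by case/orP: (leq_total a b) => /H H'; [apply: H'|apply/esym/H'].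
apply/eqP; rewrite eq_sym eqn_mod_dvd // -(Gauss_dvdr _ cop) mulnBr.
by rewrite -eqn_mod_dvd ?leq_mul // E.
Qed.

Section Sums.
Variable R : realFieldType.
Implicit Types (f g a : nat -> R) (n d P X Y : nat).

(** Vanishing beyond n lets both sides range over h < n, so that no
    hyperbolic condition d * k < n has to be carried around. *)
Lemma sum_multiples n d f : (0 < d)%N -> (forall h, (n <= h)%N -> f h = 0) ->
  \sum_(h < n | (d %| h)%N) f h = \sum_(k < n) f (d * k)%N.
Proof.
move=> d0 f0.
have -> : \sum_(k < n) f (d * k)%N =
    \sum_(k < n) \sum_(h < n | h == d * k :> nat) f h.
  apply: eq_bigr => k _; rewrite (big_ord1_eq _ f).
  by case: ltnP => // /f0.
rewrite (exchange_big_dep (fun h : 'I_n => (d %| h)%N)) /=; last first.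
  by move=> k h _ /eqP ->; rewrite dvdn_mulr.
apply: eq_bigr => h /dvdnP[k hk].
have kn : (k < n)%N.
  by apply: leq_ltn_trans (ltn_ord h); rewrite hk leq_pmulr.
rewrite (big_pred1 (Ordinal kn)) // => i.
by rewrite /= -val_eqE /= hk mulnC eqn_pmul2l // eq_sym.
Qed.

Lemma sum_truncated n d f : (0 < n)%N -> (0 < d)%N ->
  \sum_(k < n | (d * k < n)%N) f k = \sum_(k < (n.-1 %/ d).+1) f k.
Proof.
move=> n0 d0.
have E k : (d * k < n)%N = (k < (n.-1 %/ d).+1)%N.
  by rewrite ltnS leq_divRL // mulnC; case: n n0.
have le_n : ((n.-1 %/ d).+1 <= n)%N.
  by rewrite -[X in (_ <= X)%N](prednK n0) ltnS leq_div.
rewrite (big_ord_widen n f le_n).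
by apply: eq_bigl => k; rewrite E.
Qed.

Lemma sum_block f P k X : \sum_(x < k * P + X) f x =
  \sum_(i < k) \sum_(x < P) f (i * P + x)%N + \sum_(x < X) f (k * P + x)%N.
Proof.
elim: k X => [|k IH] X.
  by rewrite mul0n big_ord0 add0r.
rewrite mulSnr -addnA IH big_ord_recr /= -addrA; congr (_ + _).
rewrite big_split_ord /=; congr (_ + _).
by apply: eq_bigr => x _; rewrite addnA.
Qed.

Lemma periodicMn f P k x : (forall y, f (y + P)%N = f y) -> f (k * P + x)%N = f x.
Proof.
by move=> fP; elim: k => [|k IH] //; rewrite mulSnr -addnA addnCA addnC fP.
Qed.

(** Full periods cancel, hence less than one period remains. *)
Lemma sum_periodic_le f P B X : (0 < P)%N ->
  (forall x, f (x + P)%N = f x) -> \sum_(x < P) f x = 0 ->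
  (forall x, `|f x| <= B) -> `|\sum_(x < X) f x| <= P%:R * B.
Proof.
move=> P0 fP f0 fB; rewrite (divn_eq X P) sum_block big1 ?add0r; last first.
  move=> i _; rewrite -[RHS]f0; apply: eq_bigr => x _; exact: periodicMn.
apply: le_trans (ler_norm_sum _ _ _) _.
apply: (@le_trans _ _ (\sum_(x < X %% P) B)); first exact: ler_sum.
have B0 : 0 <= B := le_trans (normr_ge0 _) (fB 0).
rewrite sumr_const card_ord -[B *+ _]mulr_natl ler_wpM2r // ler_nat.
by rewrite ltnW // ltn_pmod.
Qed.

(** An affine map with invertible slope permutes the residue classes. *)
Lemma sum_affine f P d c : (forall x, f (x + P)%N = f x) -> coprime P d ->
  \sum_(x < P) f (c + d * x)%N = \sum_(x < P) f x.
Proof.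
move=> fP cop; case: P fP cop => [|P] fP cop; first by rewrite !big_ord0.
have fmod x : f (x %% P.+1)%N = f x.
  by rewrite [in RHS](divn_eq x P.+1) periodicMn.
pose s (x : 'I_P.+1) : 'I_P.+1 := inord ((c + d * x) %% P.+1).
have sE x : s x = ((c + d * x) %% P.+1)%N :> nat by rewrite inordK ?ltn_pmod.
rewrite [RHS](reindex_inj (h := s)) /=; last first.
  move=> x y /(congr1 val); rewrite /= !sE => /eqP.
  rewrite eqn_modDl => /eqP E; apply: val_inj => /=.
  rewrite -(modn_small (ltn_ord x)) -(modn_small (ltn_ord y)).
  exact: (modn_mulI cop).
by apply: eq_bigr => x _; rewrite sE fmod.
Qed.

(** The Chinese remainder theorem, as independence of two periodic functions
    with coprime periods. *)
Lemma sum_mul_coprime_periods f g P P' : coprime P P' ->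
  (forall x, f (x + P)%N = f x) -> (forall x, g (x + P')%N = g x) ->
  \sum_(x < P * P') f x * g x = (\sum_(x < P) f x) * \sum_(x < P') g x.
Proof.
move=> cop fP gP; rewrite mulnC -[(P' * P)%N]addn0 (sum_block (fun x => f x * g x)) big_ord0 addr0.
rewrite exchange_big mulr_suml; apply: eq_bigr => x _ /=.
rewrite -(sum_affine x gP (d := P)) 1?coprime_sym // mulr_sumr.
by apply: eq_bigr => i _; rewrite periodicMn // addnC mulnC.
Qed.

(** Summation by parts: a monotone factor does not spoil the cancellation in
    partial sums. It is applied to logarithms and to the identity. *)
Lemma abel_sum_le a f B X : (forall x, 0 <= a x) ->
  {homo a : x y / (x <= y)%N >-> x <= y} ->
  (forall x, `|\sum_(i < x) f i| <= B) ->
  `|\sum_(i < X) a i * f i| <= 2 * a X * B.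
Proof.
move=> a0 aM fB; set F := fun x => \sum_(i < x) f i.
have B0 : 0 <= B := le_trans (normr_ge0 _) (fB 0%N).
have -> : \sum_(i < X) a i * f i =
    a X * F X - \sum_(i < X) (a i.+1 - a i) * F i.+1.
  elim: X => [|X IH]; first by rewrite /F !big_ord0 mulr0 subr0.
  rewrite !big_ord_recr /= IH.
  have -> : F X.+1 = F X + f X by rewrite /F big_ord_recr.
  ring.
apply: le_trans (ler_normB _ _) _.
have -> : 2 * a X * B = a X * B + a X * B by ring.
apply: lerD; first by rewrite normrM ger0_norm // ler_wpM2l ?fB.
apply: le_trans (ler_norm_sum _ _ _) _.
apply: (@le_trans _ _ (\sum_(i < X) (a i.+1 - a i) * B)).
  apply: ler_sum => i _; have ai : 0 <= a i.+1 - a i by rewrite subr_ge0 aM.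
  by rewrite normrM ger0_norm // ler_wpM2l // fB.
rewrite -mulr_suml ler_wpM2r //.
have -> : \sum_(i < X) (a i.+1 - a i) = a X - a 0%N.
  by elim: X => [|X IH]; rewrite ?big_ord0 ?subrr // big_ord_recr /= IH; ring.
by rewrite gerBl.
Qed.

Lemma sum_congruent_le (A : pred nat) P X : (0 < P)%N ->
  (forall x y, A x -> A y -> x = y %[mod P]) ->
  \sum_(x < X) (A x)%:R <= X%:R / P%:R + 1 :> R.
Proof.
move=> P0 AP.
have E : \sum_(x < X) (A x)%:R = #|[set x : 'I_X | A x]|%:R :> R.
  rewrite -natr_sum; congr (_ %:R).
  by rewrite -sum1_card [RHS]big_mkcond; apply: eq_bigr => x _; rewrite inE; case: (A x).
rewrite E.
pose s (x : 'I_X) : 'I_(X %/ P).+1 := inord (x %/ P).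
have sE x : s x = (x %/ P)%N :> nat.
  by rewrite inordK // ltnS leq_div2r // ltnW.
have : (#|[set x : 'I_X | A x]| <= (X %/ P).+1)%N.
  rewrite -[X in (_ <= X)%N](card_ord (X %/ P).+1).
  rewrite -(card_in_imset (f := s)); first exact: max_card.
  move=> x y; rewrite !inE => Ax Ay /(congr1 val); rewrite /= !sE => q.
  by apply: val_inj; rewrite /= (divn_eq x P) (divn_eq y P) q (AP x y).
rewrite -(ler_nat R) => /le_trans; apply.
rewrite -natr1 lerD2r ler_pdivlMr ?ltr0n //.
by rewrite -natrM ler_nat leq_trunc_div.
Qed.

(** Expand the sum of (x - t c y) ^ 2 / c, which is nonnegative, and minimise
    over t. The weights spare a dyadic decomposition in the bilinear sums. *)
Lemma cauchy_schwarz_weighted (I : finType) (p : pred I) (x y c : I -> R) :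
  (forall i, p i -> 0 < c i) ->
  (\sum_(i | p i) x i * y i) ^+ 2 <=
  (\sum_(i | p i) x i ^+ 2 / c i) * \sum_(i | p i) c i * y i ^+ 2.
Proof.
move=> c0; set A := \sum_(i | p i) _ / _; set B := \sum_(i | p i) c _ * _.
set S := \sum_(i | p i) _.
have H t : 0 <= A - 2 * t * S + t ^+ 2 * B.
  have -> : A - 2 * t * S + t ^+ 2 * B =
     \sum_(i | p i) (x i - t * c i * y i) ^+ 2 / c i.
    rewrite /A /S /B !mulr_sumr -sumrB -big_split /=; apply: eq_bigr => i pi.
    have := c0 i pi; move: (c i) => ci ci0.
    by field; rewrite gt_eqF.
  by apply: sumr_ge0 => i pi; rewrite divr_ge0 ?sqr_ge0 // ltW // c0.
have B0 : 0 <= B by apply: sumr_ge0 => i pi; rewrite mulr_ge0 ?sqr_ge0 // ltW // c0.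
(* If B = 0, the expression is affine in t, whence S = 0. *)
have [B00|Bn0] := eqVneq B 0.
  have := H ((A + 1) / (2 * S)); rewrite B00 !mulr0 addr0.
  have [->|S0] := eqVneq S 0; first by rewrite expr0n.
  have -> : 2 * ((A + 1) / (2 * S)) * S = A + 1 by field.
  lra.
have := H (S / B).
have -> : A - 2 * (S / B) * S + (S / B) ^+ 2 * B = (A * B - S ^+ 2) / B.
  by field.
by rewrite pmulr_lge0 ?invr_gt0 ?lt_def ?Bn0 // subr_ge0.
Qed.

End Sums.

(** * A kernel of mean zero detecting one residue class modulo q ^ 2 *)

Section Kernel.
Variable R : realFieldType.

(** The factor q (q - 1) = totient (q ^ 2) balances the number of classes
    modulo q ^ 2 that are prime to q. *)
Definition ap_kernel (q n m : nat) : R :=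
  (q * q.-1)%:R * (m == n %[mod q ^ 2])%:R - (~~ (q %| m)%N)%:R.

Implicit Types q n m d e X : nat.

Lemma ap_kernel_periodic q n m : ap_kernel q n (m + q ^ 2) = ap_kernel q n m.
Proof. by rewrite /ap_kernel modnDr dvdn_addl // dvdn_exp. Qed.

Lemma ap_kernel_periodic_mul q n d x Z : (q ^ 2 %| Z)%N ->
  ap_kernel q n (d * (x + Z)) = ap_kernel q n (d * x).
Proof.
move=> /dvdnP[k ->]; rewrite mulnDr addnC mulnA.
exact: (periodicMn _ _ (ap_kernel_periodic q n)).
Qed.

Lemma ap_kernel_norm_le q n m : `|ap_kernel q n m| <=
  (q ^ 2)%:R * (m == n %[mod q ^ 2])%:R + 1.
Proof.
have H : (q * q.-1)%:R <= (q ^ 2)%:R :> R.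
  by rewrite ler_nat leq_mul // leq_pred.
have H0 : 0 <= (q * q.-1)%:R :> R by rewrite ler0n.
rewrite /ap_kernel; move: (q * q.-1)%:R (q ^ 2)%:R H H0 => /= a b ab a0.
rewrite ler_norml; case: (_ == _); case: (~~ _) => /=; apply/andP; split; lra.
Qed.

Lemma dvdn_congr_sq q n m : (0 < q)%N -> (m == n %[mod q ^ 2])%N -> (q %| m)%N = (q %| n)%N.
Proof.
move=> q0 /eqP mn.
have D x : (q %| x %% q ^ 2)%N = (q %| x)%N by rewrite /dvdn modn_dvdm ?dvdn_exp.
by rewrite -D mn D.
Qed.

(** Multiples of q carry no weight, so that dilations of the kernel need no
    coprimality assumption below. *)
Lemma ap_kernel_dvd q n m : (0 < q)%N -> ~~ (q %| n)%N -> (q %| m)%N -> ap_kernel q n m = 0.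
Proof.
move=> q0 qn qm; rewrite /ap_kernel qm subr0.
case: eqP => [/eqP/dvdn_congr_sq|_]; rewrite ?mulr0 // => E.
by move: qn; rewrite -E // qm.
Qed.

Lemma ap_kernel_norm_sq q n m : prime q -> `|ap_kernel q n m| <= (q ^ 2)%:R.
Proof.
move=> qp.
have H : (q * q.-1)%:R + 1 <= (q ^ 2)%:R :> R.
  by rewrite natr1 ler_nat; case: q qp => // q _ /=; rewrite ltn_pmul2l.
have H0 : 0 <= (q * q.-1)%:R :> R by rewrite ler0n.
rewrite /ap_kernel; move: (q * q.-1)%:R (q ^ 2)%:R H H0 => /= a b ab a0.
rewrite ler_norml; case: (_ == _); case: (~~ _) => /=; apply/andP; split; lra.
Qed.

(** If q does not divide d, then x -> d x permutes the classes modulo q ^ 2,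
    and the class of n balances the totient (q ^ 2) classes prime to q. *)
Lemma ap_kernel_sum_period q n d : prime q -> ~~ (q %| n)%N ->
  \sum_(x < q ^ 2) ap_kernel q n (d * x) = 0.
Proof.
move=> qp qn; have q0 := prime_gt0 qp.
have [qd|qd] := boolP (q %| d)%N.
  by apply: big1 => x _; rewrite ap_kernel_dvd // dvdn_mulr.
under eq_bigr => x _ do rewrite -[(d * x)%N]add0n.
rewrite (sum_affine _ (ap_kernel_periodic q n)); last first.
  by rewrite coprimeXl // prime_coprime.
rewrite /ap_kernel sumrB -mulr_sumr.
have -> : \sum_(x < q ^ 2) (x == n %[mod q ^ 2])%:R = 1 :> R.
  have nq : (n %% q ^ 2 < q ^ 2)%N by rewrite ltn_pmod // expn_gt0 q0.
  rewrite (bigD1 (Ordinal nq)) //= modn_mod eqxx big1 ?addr0 // => x.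
  rewrite -val_eqE /= => /negbTE; rewrite (modn_small (ltn_ord x)).
  by move=> ->.
rewrite mulr1 -natr_sum.
have -> : (\sum_(x < q ^ 2) ~~ (q %| x))%N = (q * q.-1)%N.
  transitivity (totient (q ^ 2)); last by rewrite totient_pfactor // expn1 mulnC.
  rewrite totient_count_coprime big_mkord; apply: eq_bigr => x _.
  by rewrite coprime_pexpl // prime_coprime.
by rewrite subrr.
Qed.

Lemma ap_kernel_sum_le q n d X : prime q -> ~~ (q %| n)%N ->
  `|\sum_(x < X) ap_kernel q n (d * x)| <= (q ^ 4)%:R.
Proof.
move=> qp qn.
apply: le_trans (sum_periodic_le (f := fun x => ap_kernel q n (d * x)) (P := (q ^ 2)%N)
   (B := (q ^ 2)%:R) X _ _ _ _) _.
- by rewrite expn_gt0 prime_gt0.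
- by move=> x; apply: ap_kernel_periodic_mul.
- exact: ap_kernel_sum_period.
- by move=> x; apply: ap_kernel_norm_sq.
- by rewrite -natrM -expnD.
Qed.

(** For distinct primes the mean over the common period factors into two means,
    both zero. This cancellation is the source of the whole gain. *)
Lemma ap_kernel_corr_le q q' n d d' X : prime q -> prime q' -> q != q' ->
  ~~ (q %| n)%N -> ~~ (q' %| n)%N ->
  `|\sum_(x < X) ap_kernel q n (d * x) * ap_kernel q' n (d' * x)| <= ((q * q') ^ 4)%:R.
Proof.
move=> qp qp' qq' qn qn'.
have cop : coprime (q ^ 2) (q' ^ 2).
  by rewrite coprimeXl // coprimeXr // prime_coprime // dvdn_prime2.
apply: le_trans (sum_periodic_le
   (f := fun x => ap_kernel q n (d * x) * ap_kernel q' n (d' * x)) (P := (q ^ 2 * q' ^ 2)%N)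
   (B := (q ^ 2 * q' ^ 2)%:R) X _ _ _ _) _.
- by rewrite muln_gt0 !expn_gt0 !prime_gt0.
- by move=> x; congr (_ * _); apply: ap_kernel_periodic_mul; [apply: dvdn_mulr|apply: dvdn_mull].
- rewrite (sum_mul_coprime_periods (f := fun x => ap_kernel q n (d * x))
    (g := fun x => ap_kernel q' n (d' * x)) cop).
  + by rewrite /= ap_kernel_sum_period // mul0r.
  + by move=> x; apply: ap_kernel_periodic_mul.
  + by move=> x; apply: ap_kernel_periodic_mul.
- by move=> x; rewrite normrM natrM ler_pM // ap_kernel_norm_sq.
- by rewrite -natrM ler_nat expnMn; lia.
Qed.

(** For one prime there is no cancellation: bound absolute values. Both kernels
    have a peak at the same x only if e x and e' x agree modulo q ^ 2, which
    forces e = e' modulo q ^ 2 since x is then invertible. *)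
Lemma ap_kernel_diag_le q n e e' X : prime q -> ~~ (q %| n)%N ->
  \sum_(x < X) `|ap_kernel q n (e * x)| * `|ap_kernel q n (e' * x)| <=
  (X%:R + (q ^ 2)%:R) * ((q ^ 2)%:R * (e == e' %[mod q ^ 2])%:R + 2) + X%:R.
Proof.
move=> qp qn; have q0 := prime_gt0 qp; set P := (q ^ 2)%N.
have P0 : (0 < P)%N by rewrite expn_gt0 q0.
pose c d x := (d * x == n %[mod P])%N.
have unitP d x : c d x -> coprime P d /\ coprime P x.
  move=> /(dvdn_congr_sq q0) E.
  have : ~~ (q %| d * x)%N by rewrite E.
  rewrite Euclid_dvdM // negb_or => /andP[qd qx].
  by rewrite !coprime_pexpl // !prime_coprime.
have cnt (A : pred nat) d : (forall x, A x -> c d x) ->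
    \sum_(x < X) (A x)%:R <= X%:R / P%:R + 1 :> R.
  move=> Ac; apply: sum_congruent_le => // x y /Ac cx /Ac cy.
  have [cop _] := unitP _ _ cx.
  by apply: (modn_mulI (d := d)) => //; move/eqP: cx => ->; move/eqP: cy => ->.
have cnt1 d := @cnt (c d) d (fun x => id).
have cnt2 : \sum_(x < X) ((c e x) && (c e' x))%:R <=
     (X%:R / P%:R + 1) * (e == e' %[mod P])%:R :> R.
  case E : (e == e' %[mod P]); rewrite /= ?mulr1 ?mulr0.
    by apply: (cnt (fun x => c e x && c e' x) e) => x /andP[].
  rewrite big1 // => x _; case: andP => // -[ce ce'].
  have [_ cx] := unitP _ _ ce.
  suff : (e == e' %[mod P]) by rewrite E.
  apply/eqP/(modn_mulI (d := x)) => //; rewrite !(mulnC x).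
  by move/eqP: ce => ->; move/eqP: ce' => ->.
(* Expand the product of the bounds P [peak] + 1 for both kernels. *)
apply: (@le_trans _ _ (\sum_(x < X) (P%:R ^+ 2 * ((c e x) && (c e' x))%:R +
    P%:R * (c e x)%:R + P%:R * (c e' x)%:R + 1))).
  apply: ler_sum => x _.
  apply: le_trans (ler_pM (normr_ge0 _) (normr_ge0 _) (ap_kernel_norm_le _ _ _)
      (ap_kernel_norm_le _ _ _)) _.
  rewrite -/P -/(c e x) -/(c e' x).
  by case: (c e x); case: (c e' x); rewrite /= ?mulr0 ?mulr1 ?add0r ?addr0; lra.
rewrite !big_split /= -!mulr_sumr sumr_const card_ord.
have := cnt1 e; have := cnt1 e'; move: cnt2.
have Pp : 0 < P%:R :> R by rewrite ltr0n.
have -> : X%:R / P%:R + 1 = (X%:R + P%:R) / P%:R :> R by field; rewrite gt_eqF.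
set s1 := \sum_(x < X) _; set s2 := \sum_(x < X) _; set s3 := \sum_(x < X) _.
move: P%:R X%:R Pp s1 s2 s3 => p y p0 s1 s2 s3 h1 h2 h3.
rewrite mulrDr; apply: lerD => //.
have -> : (y + p) * (p * (e == e' %[mod P])%:R) + (y + p) * 2 =
  p ^+ 2 * ((y + p) / p * (e == e' %[mod P])%:R) + p * ((y + p) / p) + p * ((y + p) / p).
  by field; rewrite gt_eqF.
by rewrite !lerD // ler_pM2l // exprn_gt0.
Qed.

End Kernel.

(** * Divisor sums and the Moebius function *)

Lemma sum_ord_extend (V : nmodType) (n1 n2 : nat) (P : pred nat) (F : nat -> V) :
  (n1 <= n2)%N -> (forall i, (n1 <= i)%N -> P i -> F i = 0) ->
  \sum_(i < n2 | P i) F i = \sum_(i < n1 | P i) F i.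
Proof.
move=> le F0; rewrite (big_ord_widen_cond n2 P F le) [LHS]big_mkcond [RHS]big_mkcond.
apply: eq_bigr => i _; case: (boolP (P i)) => //= Pi.
by case: ltnP => // /F0 ->.
Qed.

Section Divisors.
Variable R : realFieldType.

(** The term h = 0 vanishes, as the inverse of 0 is 0. *)
Definition harmonic_sum n : R := \sum_(h < n) h%:R^-1.

Lemma harmonic_ge0 n : 0 <= harmonic_sum n.
Proof. by apply: sumr_ge0 => h _; rewrite invr_ge0. Qed.

Lemma harmonic_pow2_le n t : (n <= 2 ^ t)%N -> harmonic_sum n <= t%:R.
Proof.
move=> le; apply: (@le_trans _ _ (harmonic_sum (2 ^ t))).
  rewrite /harmonic_sum (big_ord_widen _ (fun h => h%:R^-1) le) [leRHS](bigID (fun i : 'I__ => (i < n)%N)) /=.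
  by rewrite lerDl; apply: sumr_ge0 => h _; rewrite invr_ge0.
elim: t {le} => [|t IH]; first by rewrite /harmonic_sum big_ord_recl big_ord0 /= invr0 add0r.
rewrite /harmonic_sum expnS mul2n -addnn big_split_ord /= -natr1.
apply: lerD => //.
have p0 : 0 < (2 ^ t)%:R :> R by rewrite ltr0n expn_gt0.
apply: (@le_trans _ _ (\sum_(i < 2 ^ t) (2 ^ t)%:R^-1)).
  apply: ler_sum => i _; rewrite lef_pV2 ?posrE //.
    by rewrite ler_nat leq_addr.
  by rewrite ltr0n addn_gt0 expn_gt0.
by rewrite sumr_const card_ord -[_ *+ _]mulr_natl divff // gt_eqF.
Qed.

Definition num_divisors h := size (divisors h).

(** A divisor d of a b is the product of gcd(d, a), which divides a, and of a
    cofactor dividing b. *)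
Lemma num_divisors_mul_le a b : (0 < a)%N -> (0 < b)%N -> (num_divisors (a * b) <= num_divisors a * num_divisors b)%N.
Proof.
move=> a0 b0; rewrite /num_divisors -(size_allpairs muln); apply: uniq_leq_size.
  exact: divisors_uniq.
move=> d; rewrite -dvdn_divisors ?muln_gt0 ?a0 // => dab.
apply/allpairsP; exists (gcdn d a, d %/ gcdn d a)%N; split=> /=.
- by rewrite -dvdn_divisors // dvdn_gcdr.
- rewrite -dvdn_divisors //.
  have d0 : (0 < gcdn d a)%N by rewrite gcdn_gt0 a0 orbT.
  have cop : coprime (d %/ gcdn d a) (a %/ gcdn d a).
    rewrite /coprime -(eqn_pmul2l d0) muln1 muln_gcdr.
    by rewrite !(mulnC (gcdn d a)) !divnK ?dvdn_gcdl ?dvdn_gcdr.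
  rewrite -(Gauss_dvdr _ cop) -(dvdn_pmul2l d0) mulnA.
  by rewrite !(mulnC (gcdn d a)) !divnK ?dvdn_gcdl ?dvdn_gcdr.
- by rewrite mulnC divnK // dvdn_gcdl.
Qed.

Lemma num_divisors_sumE n h : (0 < h < n)%N -> (num_divisors h)%:R = \sum_(d < n | (d %| h)%N) 1 :> R.
Proof.
move=> /andP[h0 hn].
transitivity ((\sum_(d < n | (d %| h)%N) 1)%N%:R : R); last by rewrite natr_sum.
congr (_ %:R); rewrite -(big_mkord (fun d => (d %| h)%N) (fun=> 1%N)) sum1_count -size_filter.
apply/perm_size/uniq_perm; rewrite ?divisors_uniq ?filter_uniq ?iota_uniq //.
move=> d; rewrite mem_filter mem_index_iota -dvdn_divisors //=.
by case: (boolP (d %| h)%N) => //= /(dvdn_leq h0)/leq_ltn_trans/(_ hn) ->.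
Qed.

(** Open the divisor function and write h = d k. *)
Lemma sum_num_divisors_le n (f : nat -> R) : (forall h, 0 <= f h) -> f 0%N = 0 ->
  \sum_(h < n) (num_divisors h)%:R * f h <= \sum_(d < n | (0 < d)%N) \sum_(k < n) if (d * k < n)%N then f (d * k)%N else 0.
Proof.
move=> f0 f00.
have -> : \sum_(h < n) (num_divisors h)%:R * f h =
  \sum_(h < n) \sum_(d < n | (0 < d)%N && (d %| h)%N) f h.
  apply: eq_bigr => h _; case: (posnP h) => [->|h0].
    by rewrite f00 mulr0 big1.
  rewrite (@num_divisors_sumE n) ?h0 //= mulr_suml.
  apply: eq_big => [d|d _]; last by rewrite mul1r.
  by case: (posnP d) => //= ->; rewrite dvd0n eqn0Ngt h0.
rewrite (exchange_big_dep (fun d : 'I_n => (0 < d)%N)) /=; last by move=> h d _ /andP[].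
apply: ler_sum => d d0; rewrite le_eqVlt; apply/orP; left; apply/eqP.
rewrite -(@sum_multiples _ n d (fun h => if (h < n)%N then f h else 0)) //; last first.
  by move=> h; rewrite leqNgt => /negbTE ->.
by rewrite d0 /=; apply: eq_bigr => h _; rewrite ltn_ord.
Qed.

Lemma sum_num_divisors_harmonic_le n : \sum_(h < n) (num_divisors h)%:R / h%:R <= harmonic_sum n ^+ 2.
Proof.
apply: le_trans (sum_num_divisors_le (f := fun h => h%:R^-1) _ _ _) _.
- by move=> h; rewrite invr_ge0.
- by rewrite invr0.
rewrite expr2 /harmonic_sum mulr_suml [leLHS]big_mkcond; apply: ler_sum => d _.
have H : 0 <= d%:R^-1 * (\sum_(h < n) h%:R^-1) :> R.
  by rewrite mulr_ge0 ?invr_ge0 // harmonic_ge0.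
case: ifP => // _; rewrite mulr_sumr; apply: ler_sum => k _.
by case: ifP => _; rewrite ?natrM ?invfM // mulr_ge0 // invr_ge0.
Qed.

(** One divisor function is opened; the other one is submultiplicative, which
    reduces the second moment to the square of the first one. *)
Lemma sum_num_divisors_sq_le n : \sum_(h < n) (num_divisors h)%:R ^+ 2 / h%:R <= harmonic_sum n ^+ 4.
Proof.
under eq_bigr do rewrite expr2 -mulrA.
apply: le_trans (sum_num_divisors_le (f := fun h => (num_divisors h)%:R / h%:R) _ _ _) _.
- by move=> h; rewrite divr_ge0.
- by rewrite invr0 mulr0.
apply: (@le_trans _ _ ((\sum_(h < n) (num_divisors h)%:R / h%:R) ^+ 2)); last first.
  rewrite (exprM _ 2 2) ler_sqr ?nnegrE ?exprn_ge0 ?harmonic_ge0 //.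
    exact: sum_num_divisors_harmonic_le.
  by apply: sumr_ge0 => h _; rewrite divr_ge0.
rewrite expr2 mulr_suml [leLHS]big_mkcond; apply: ler_sum => d _.
have H : 0 <= \sum_(h < n) (num_divisors h)%:R / h%:R :> R.
  by apply: sumr_ge0 => h _; rewrite divr_ge0.
have t0 : 0 <= (num_divisors d)%:R / d%:R :> R by rewrite divr_ge0.
case: ifP => d0; last by rewrite mulr_ge0.
rewrite mulr_sumr; apply: ler_sum => k _.
have [->|k0] := posnP k; first by rewrite muln0 invr0 !mulr0; case: ifP.
case: ifP => _; last by rewrite mulr_ge0 // divr_ge0.
rewrite natrM invfM mulrACA ler_wpM2r ?mulr_ge0 ?invr_ge0 //.
by rewrite -natrM ler_nat num_divisors_mul_le.
Qed.

(** A prime whose exponent is not one kills the product; this form makes the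
    effect of one more prime factor visible. *)
Definition moebius d : R := \prod_(p <- primes d) (if logn p d == 1%N then -1 else 0).

Lemma moebius1 : moebius 1 = 1. Proof. by rewrite /moebius big_nil. Qed.

Lemma moebius_norm_le d : `|moebius d| <= 1.
Proof.
rewrite /moebius; elim: (primes d) => [|p s IH]; first by rewrite big_nil normr1.
rewrite big_cons normrM -[leRHS]mulr1 ler_pM //.
by case: ifP => _; rewrite ?normrN ?normr1 ?normr0.
Qed.

Lemma moebius_mul_prime p d : prime p -> (0 < d)%N ->
  moebius (p * d) = if (p %| d)%N then 0 else - moebius d.
Proof.
move=> pp d0; have p0 := prime_gt0 pp.
case: ifPn => pd.
  rewrite /moebius (big_rem p) /=; last by rewrite mem_primes pp muln_gt0 p0 d0 dvdn_mulr.
  rewrite lognM // (pfactorK 1 pp).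
  have : (0 < logn p d)%N by rewrite logn_gt0 mem_primes pp d0.
  by case: (logn p d) => // k _; rewrite mul0r.
have np : p \notin primes d by rewrite mem_primes pp d0.
rewrite /moebius (perm_big (p :: primes d)) /=; last first.
  apply: uniq_perm; rewrite ?primes_uniq //= ?np ?primes_uniq //.
  by move=> q; rewrite primesM // inE primes_prime // inE.
rewrite big_cons lognM // logn_prime // eqxx.
have -> : logn p d = 0%N by apply/eqP; rewrite -leqn0 leqNgt logn_gt0.
rewrite mulN1r; congr (- _); apply: eq_big_seq => q qd.
rewrite lognM // logn_prime //.
by case: (eqVneq q p) => // qp; rewrite -qp qd in np.
Qed.

(** Fix a prime p dividing h: the divisors d and p d, for d prime to p, cancel
    in pairs, and the divisors divisible by p ^ 2 contribute nothing. *)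
Lemma sum_moebius n h : (0 < h < n)%N ->
  \sum_(d < n | (d %| h)%N) moebius d = (h == 1%N)%:R.
Proof.
move=> /andP[h0 hn]; have [h1|h1] := eqVneq h 1%N.
  rewrite h1 in hn *; rewrite (bigD1 (Ordinal hn)) //= moebius1 big1 ?addr0 // => d.
  by rewrite dvdn1 -val_eqE /= => /andP[/eqP ->].
have h2 : (1 < h)%N by rewrite ltn_neqAle eq_sym h1.
have := pdiv_prime h2; have := pdiv_dvd h; move: (pdiv h) => p ph pp.
rewrite (bigID (fun d : 'I_n => (p %| d)%N)) /=.
pose F d := if (d < n)%N && (d %| h)%N then moebius d else 0.
have -> : \sum_(d < n | (d %| h)%N && (p %| d)%N) moebius d = \sum_(d < n | (p %| d)%N) F d.
  rewrite [RHS]big_mkcond [LHS]big_mkcond; apply: eq_bigr => d _.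
  by rewrite /F ltn_ord /=; case: (_ %| h)%N; case: (p %| _)%N.
rewrite sum_multiples ?prime_gt0 //; last by move=> k; rewrite /F leqNgt => /negbTE ->.
rewrite [X in _ + X]big_mkcond -big_split big1 //= => d _.
have [dp|pd] := boolP (p %| d)%N.
  rewrite andbF addr0 /F; case: ifP => // /andP[_ H].
  rewrite moebius_mul_prime ?dp //.
  by move: (dvdn_gt0 h0 H); rewrite muln_gt0 => /andP[].
have pdh : (p * d %| h)%N = (d %| h)%N.
  by rewrite Gauss_dvd ?ph // prime_coprime.
rewrite andbT /F pdh; case: (boolP (d %| h)%N) => dh; rewrite ?andbF ?addr0 // andbT.
have -> : (p * d < n)%N by apply: leq_ltn_trans hn; rewrite dvdn_leq // pdh.
by rewrite moebius_mul_prime ?(negbTE pd) ?addNr // (dvdn_gt0 h0 dh).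
Qed.

End Divisors.

(** * Logarithms, the von Mangoldt function and Chebyshev's bound *)

Lemma sum_const_lt_le (R : realFieldType) n b (c : R) : 0 <= c ->
  \sum_(k < n | (k < b)%N) c <= b%:R * c.
Proof.
move=> c0; have [bn|nb] := leqP b n.
  by rewrite -(big_ord_widen n (fun=> c) bn) sumr_const card_ord mulr_natl.
apply: (@le_trans _ _ (\sum_(k < n) c)).
  by rewrite big_mkcond; apply: ler_sum => k _; case: ifP.
by rewrite sumr_const card_ord -[leLHS]mulr_natl ler_wpM2r // ler_nat ltnW.
Qed.

Section VonMangoldt.
Variables (R : realFieldType) (lg : nat -> R).
Hypothesis lgM : forall a b, (0 < a)%N -> (0 < b)%N -> lg (a * b) = lg a + lg b.
Hypothesis lg_mono : {homo lg : x y / (x <= y)%N >-> x <= y}.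
Hypothesis lg0 : lg 0 = 0.
Hypothesis lg2 : lg 2 = 1.

Lemma lg1 : lg 1 = 0.
Proof. by have := lgM (ltn0Sn 0) (ltn0Sn 0); rewrite mul1n; lra. Qed.

Lemma lg_ge0 a : 0 <= lg a.
Proof. by rewrite -lg0 lg_mono. Qed.

Lemma lg_ge1 a : (1 < a)%N -> 1 <= lg a.
Proof. by move=> a1; rewrite -lg2 lg_mono. Qed.

Lemma lgX a k : (0 < a)%N -> lg (a ^ k) = k%:R * lg a.
Proof.
move=> a0; elim: k => [|k IH]; first by rewrite expn0 lg1 mul0r.
by rewrite expnS lgM ?expn_gt0 ?a0 // IH -natr1; ring.
Qed.

Lemma lg_le a t : (a <= 2 ^ t)%N -> lg a <= t%:R.
Proof. by move=> /lg_mono/le_trans; apply; rewrite lgX // lg2 mulr1. Qed.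

Lemma lg_factor m n : (0 < m < n)%N ->
  lg m = \sum_(p < n | prime p) (logn p m)%:R * lg p.
Proof.
move=> /andP[m0 mn].
have -> : lg m = lg (\prod_(p < n | prime p) p ^ logn p m)%N.
  congr lg; case: n mn => // n; rewrite ltnS => mn.
  rewrite -[LHS](partnT m0) (widen_partn _ mn) big_mkord.
  rewrite [RHS]big_mkcond [LHS]big_mkcond; apply: eq_bigr => p _ /=.
  by case: ifPn => // /negbTE np; rewrite lognE np.
suff: (0 < \prod_(p < n | prime p) p ^ logn p m)%N /\
  lg (\prod_(p < n | prime p) p ^ logn p m)%N =
  \sum_(p < n | prime p) (logn p m)%:R * lg p by case.
elim/big_rec2: _ => [|p x y pp [y0 <-]]; first by rewrite lg1.
have pl0 : (0 < p ^ logn p m)%N by rewrite expn_gt0 prime_gt0.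
by rewrite muln_gt0 pl0 y0 lgM // lgX // prime_gt0.
Qed.

(** Given as a sum over all pairs (p, k) with p ^ k = e, at most one of which
    exists, so that sums over e unfold to sums over prime powers by exchanging
    summations. *)
Definition vonMangoldt e : R :=
  \sum_(p < e.+1 | prime p) \sum_(k < e.+1 | (0 < k)%N && (p ^ k == e)%N) lg p.

Local Notation Lam := vonMangoldt.

(** The bound e.+1 on p and k is immaterial, because p and k are at most
    p ^ k. *)
Lemma vonMangoldt_widen e n : (e < n)%N ->
  Lam e = \sum_(p < n | prime p) \sum_(k < n | (0 < k)%N && (p ^ k == e)%N) lg p.
Proof.
move=> en; rewrite /Lam.
have lt p k : prime p -> (0 < k)%N && (p ^ k == e)%N -> (p <= e)%N && (k <= e)%N.
  move=> pp /andP[k0 /eqP <-]; rewrite (ltnW (ltn_expl _ (prime_gt1 pp))) andbT.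
  by rewrite -{1}(expn1 p) leq_exp2l // prime_gt1.
rewrite -(@sum_ord_extend _ e.+1 n prime (fun p =>
  \sum_(k < e.+1 | (0 < k)%N && (p ^ k == e)%N) lg p)) //; last first.
  by move=> p ep pp; apply: big1 => k /(lt _ _ pp); rewrite leqNgt ep.
apply: eq_bigr => p pp.
rewrite -(@sum_ord_extend _ e.+1 n (fun k => (0 < k)%N && (p ^ k == e)%N)
  (fun=> lg p)) //.
by move=> k ek /(lt _ _ pp); rewrite [(k <= e)%N]leqNgt ek andbF.
Qed.

Lemma sum_vonMangoldt n (f : nat -> R) : \sum_(e < n) Lam e * f e =
  \sum_(p < n | prime p) \sum_(k < n | (0 < k)%N && (p ^ k < n)%N)
     lg p * f (p ^ k)%N.
Proof.
under eq_bigr => e _ do rewrite (vonMangoldt_widen (ltn_ord e)) mulr_suml.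
rewrite (exchange_big_dep (fun p : 'I_n => prime p)) //=; apply: eq_bigr => p pp.
under eq_bigr do rewrite mulr_suml.
rewrite (exchange_big_dep (fun k : 'I_n => (0 < k)%N && (p ^ k < n)%N)) //=; last first.
  by move=> e k _ /andP[-> /eqP ->] /=.
apply: eq_bigr => k /andP[k0 kn]; rewrite (big_pred1 (Ordinal kn)) //.
by move=> e; rewrite pp k0 /= -val_eqE /= eq_sym.
Qed.

Lemma vonMangoldt_ge0 e : 0 <= Lam e.
Proof. by apply: sumr_ge0 => p _; apply: sumr_ge0 => k _; apply: lg_ge0. Qed.

(** The prime powers p ^ k dividing m are counted, for given p, by the exponent
    of p in m. *)
Lemma vonMangoldt_divisors m n : (0 < m < n)%N ->
  \sum_(e < n | (e %| m)%N) Lam e = lg m.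
Proof.
move=> /andP[m0 mn]; rewrite (lg_factor (n := n)) ?m0 // big_mkcond /=.
transitivity (\sum_(e < n) Lam e * (e %| m)%:R).
  by apply: eq_bigr => e _; case: (e %| m)%N; rewrite ?mulr1 ?mulr0.
rewrite (sum_vonMangoldt n (fun e => (e %| m)%N%:R)); apply: eq_bigr => p pp.
rewrite -mulr_sumr mulrC; congr (_ * _).
transitivity ((\sum_(k < n | (0 < k <= logn p m)%N) 1)%N%:R : R).
  rewrite natr_sum [RHS]big_mkcond [LHS]big_mkcond; apply: eq_bigr => k _.
  rewrite pfactor_dvdn //; case: (0 < k)%N; case: (boolP (k <= _)%N) => //= km.
    by rewrite (leq_ltn_trans _ mn) // dvdn_leq // pfactor_dvdn.
  by case: ifP.
congr (_ %:R).
have lm : (logn p m < n)%N.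
  apply: leq_ltn_trans mn; apply: ltnW; apply: leq_trans (ltn_expl _ (prime_gt1 pp)) _.
  by rewrite dvdn_leq // pfactor_dvdnn.
rewrite -(big_mkord (fun k => (0 < k <= logn p m)%N) (fun=> 1%N)) sum1_count.
rewrite -size_filter -[RHS](size_iota 1).
apply/perm_size/uniq_perm; rewrite ?filter_uniq ?iota_uniq //.
move=> k; rewrite mem_filter mem_index_iota mem_iota /= add1n ltnS andbC.
by case: (boolP (k <= _)%N); rewrite ?andbF // => /leq_ltn_trans/(_ lm) ->.
Qed.

Lemma vonMangoldt_le e : Lam e <= lg e.
Proof.
have [->|e0] := posnP e.
  rewrite /Lam big1 ?lg0 // => p pp; rewrite big1 // => k /andP[k0 /eqP].
  by move/eqP; rewrite expn_eq0 => /andP[/eqP p0]; move: pp; rewrite p0.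
rewrite -(@vonMangoldt_divisors e e.+1) ?e0 //=.
rewrite (bigD1 ord_max) ?dvdnn //= lerDl.
by apply: sumr_ge0 => d _; apply: vonMangoldt_ge0.
Qed.

Lemma bin_central_ge M : (2 ^ M <= 'C(M.*2, M))%N.
Proof.
elim: M => // M IH; rewrite doubleS binS binS expnS.
case: M IH => // M; rewrite (binS _ M); lia.
Qed.

(** By Legendre's formula the exponent is the sum over k of
    2 M / p ^ k - 2 (M / p ^ k), with rounded quotients: each term is 0 or 1,
    and is 0 once p ^ k exceeds 2 M. *)
Lemma logn_bin_central_le p M : prime p ->
  (logn p 'C(M.*2, M) <= \sum_(k < (M.*2).+1 | (0 < k) && (p ^ k < (M.*2).+1)) 1)%N.
Proof.
move=> pp; have p0 := prime_gt0 pp.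
have lM : (M <= M.*2)%N by rewrite -addnn leq_addr.
have E : (logn p 'C(M.*2, M) + (logn p M`! + logn p M`!) = logn p (M.*2)`!)%N.
  have MM : (M.*2 - M = M)%N by rewrite -addnn addnK.
  by rewrite -(bin_fact lM) MM !lognM ?muln_gt0 ?fact_gt0 ?bin_gt0.
have F : logn p M`! = (\sum_(1 <= k < (M.*2).+1) M %/ p ^ k)%N.
  rewrite logn_fact // [RHS](big_cat_nat (n := M.+1)) //= [X in (_ + X)%N]big_nat_cond.
  rewrite [X in (_ + X)%N]big1 ?addn0 // => k /andP[/andP[Mk _] _].
  by apply: divn_small; apply: leq_trans (ltn_expl _ (prime_gt1 pp)); apply: ltnW; apply: leq_trans Mk _.
rewrite -(big_mkord (fun k => (0 < k)%N && (p ^ k < (M.*2).+1)%N) (fun=> 1%N)).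
rewrite big_ltn_cond //= -(leq_add2r (logn p M`! + logn p M`!)) E F logn_fact //.
rewrite -!big_split /= [X in (_ <= X + _)%N]big_mkcond -big_split /= [leqLHS]big_nat [leqRHS]big_nat.
apply: leq_sum => k /andP[k0 _]; rewrite k0 /= ltnS.
have q0 : (0 < p ^ k)%N by rewrite expn_gt0 p0.
case: (leqP (p ^ k) M.*2) => [le|/divn_small -> //].
move: (p ^ k)%N q0 {le} => q q0.
have := divn_eq M q; have := ltn_pmod M q0; move: (M %/ q)%N (M %% q)%N => a r rq ->.
rewrite -addnn addnACA -mulnDl divnMDl //.
suff : ((r + r) %/ q <= 1)%N by lia.
by rewrite -ltnS ltn_divLR //; lia.
Qed.

(** The central binomial coefficient is at least 2 ^ M; by the bound on its
    exponents, its logarithm is at most the sum of log p over p ^ k <= 2 M. *)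
Lemma chebyshev M : M%:R <= \sum_(e < (M.*2).+1) Lam e.
Proof.
set n := (M.*2).+1.
have C0 : (0 < 'C(M.*2, M))%N by rewrite bin_gt0 -addnn leq_addr.
apply: (@le_trans _ _ (lg 'C(M.*2, M))).
  by have <- : lg (2 ^ M) = M%:R by [rewrite lgX // lg2 mulr1]; rewrite lg_mono // bin_central_ge.
rewrite (lg_factor (n := maxn 'C(M.*2, M).+1 n)) ?C0 ?leq_max ?leqnn //.
rewrite (@sum_ord_extend _ n _ prime (fun p => (logn p 'C(M.*2, M))%:R * lg p)); last 2 first.
- by rewrite leq_max leqnn orbT.
- move=> p np pp; suff -> : logn p 'C(M.*2, M) = 0%N by rewrite mul0r.
  apply/eqP; rewrite -leqn0; apply: leq_trans (logn_bin_central_le M pp) _.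
  rewrite big1 // => k /andP[k0]; rewrite ltnNge => /negP[].
  by apply: leq_trans np _; rewrite -{1}(expn1 p) leq_exp2l // prime_gt1.
have -> : \sum_(e < n) Lam e = \sum_(e < n) Lam e * 1.
  by under [RHS]eq_bigr do rewrite mulr1.
rewrite (sum_vonMangoldt n (fun=> 1)); apply: ler_sum => p pp.
rewrite -mulr_suml mulr1 sumr_const -[leRHS]mulr_natl ler_wpM2r ?lg_ge0 //.
by rewrite ler_nat -sum1_card logn_bin_central_le.
Qed.

(** A proper power p ^ k < n has p below the square root of n, and k < log n. *)
Lemma sum_vonMangoldt_nonprime n t : (n <= 2 ^ t.*2)%N ->
  \sum_(e < n | ~~ prime e) Lam e <= (2 ^ t)%:R * t.*2%:R ^+ 2.
Proof.
move=> nt.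
have -> : \sum_(e < n | ~~ prime e) Lam e = \sum_(e < n) Lam e * (~~ prime e)%:R.
  by rewrite big_mkcond; apply: eq_bigr => e _; case: (prime e); rewrite ?mulr1 ?mulr0.
rewrite (sum_vonMangoldt n (fun e => (~~ prime e)%:R)).
have b0 : 0 <= t.*2%:R ^+ 2 :> R by rewrite sqr_ge0.
apply: (@le_trans _ _ (\sum_(p < n | (p < 2 ^ t)%N) t.*2%:R ^+ 2)); last first.
  exact: sum_const_lt_le.
rewrite big_mkcond [leRHS]big_mkcond; apply: ler_sum => p _.
case: ifPn => // [pp|_]; last by case: ifP.
have p2 := prime_gt1 pp.
have lgp : lg p <= t.*2%:R by apply: lg_le; apply: leq_trans nt; apply: ltnW.
have lgp0 := lg_ge0 p.
case: ltnP => pt; last first.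
  rewrite big1 // => k /andP[k0 kn].
  have -> : k = 1%N :> nat; last by rewrite expn1 pp mulr0.
  apply/eqP; rewrite eqn_leq k0 andbT leqNgt; apply/negP => k2.
  have : (2 ^ t.*2 <= p ^ k)%N.
    rewrite -muln2 expnM; apply: (@leq_trans (p ^ 2)%N); first by rewrite leq_exp2r.
    by rewrite leq_exp2l.
  by move=> /(leq_trans nt); rewrite leqNgt kn.
apply: (@le_trans _ _ (\sum_(k < n | (k < t.*2)%N) t.*2%:R)).
  rewrite big_mkcond [leRHS]big_mkcond; apply: ler_sum => k _.
  case: ifP => [/andP[k0 kn]|_]; last by case: ifP.
  have -> : (k < t.*2)%N.
    rewrite -(ltn_exp2l _ _ (ltnSn 1)); apply: leq_trans nt; apply: leq_ltn_trans kn.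
    by rewrite leq_exp2r.
  by case: (~~ _); rewrite ?mulr1 ?mulr0.
by rewrite expr2 sum_const_lt_le.
Qed.

(** Each prime has at most log n powers below n; the loss of a logarithm against
    the sharp bound is harmless. *)
Lemma sum_vonMangoldt_le_primes n t : (n <= 2 ^ t)%N ->
  \sum_(e < n) Lam e <= (\sum_(p < n | prime p) 1) * t%:R ^+ 2.
Proof.
move=> nt.
have -> : \sum_(e < n) Lam e = \sum_(e < n) Lam e * 1.
  by under [RHS]eq_bigr do rewrite mulr1.
rewrite (sum_vonMangoldt n (fun=> 1)) mulr_suml; apply: ler_sum => p pp.
have p2 := prime_gt1 pp.
have lgp : lg p <= t%:R by apply: lg_le; apply: leq_trans nt; apply: ltnW.
have lgp0 := lg_ge0 p.
apply: (@le_trans _ _ (\sum_(k < n | (k < t)%N) t%:R)).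
  rewrite big_mkcond [leRHS]big_mkcond; apply: ler_sum => k _.
  case: ifP => [/andP[k0 kn]|_]; last by case: ifP.
  have -> : (k < t)%N.
    rewrite -(ltn_exp2l _ _ (ltnSn 1)); apply: leq_trans nt; apply: leq_ltn_trans kn.
    by rewrite leq_exp2r.
  by rewrite mulr1.
by rewrite mul1r expr2 sum_const_lt_le.
Qed.

Lemma num_prime_divisors_le n T t : (0 < n <= 2 ^ t)%N ->
  \sum_(p < T | prime p && (p %| n)%N) 1 <= t%:R :> R.
Proof.
move=> /andP[n0 nt]; apply: le_trans (lg_le nt).
rewrite (lg_factor (n := maxn T n.+1)) ?n0 ?leq_max ?leqnn ?orbT //.
rewrite (big_ord_widen_cond _ (fun p => prime p && (p %| n)%N) (fun=> 1) (leq_maxl T n.+1)).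
rewrite big_mkcond [leRHS]big_mkcond; apply: ler_sum => p _.
case: (boolP (prime p)) => //= pp.
have H : 0 <= (logn p n)%:R * lg p by rewrite mulr_ge0 ?lg_ge0.
case: (boolP (p %| n)%N) => //= pn; case: ifP => // _.
rewrite -[leLHS]mulr1; apply: ler_pM => //; last by rewrite lg_ge1 ?prime_gt1.
by rewrite ler1n logn_gt0 mem_primes pp n0.
Qed.
End VonMangoldt.

(** * The averaged kernel and its bilinear sums *)

Section Weight.
Variables (R : realFieldType) (n T : nat) (Qs : seq nat).
Hypothesis Qs_uniq : uniq Qs.
Hypothesis Qs_prime : forall q, q \in Qs -> prime q.
Hypothesis Qs_ndvd : forall q, q \in Qs -> ~~ (q %| n)%N.
Hypothesis Qs_le : forall q, q \in Qs -> (q <= T)%N.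

Local Notation ker := (ap_kernel R).
Let K : R := (size Qs)%:R.

Definition weight m : R := \sum_(q <- Qs) ker q n m.
Local Notation w := weight.

Lemma sum_size_const (c : R) : \sum_(q <- Qs) c = K * c.
Proof. by rewrite big_const_seq count_predT iter_addr_0 mulr_natl. Qed.

Lemma sum_Qs_le (f : nat -> R) c : (forall q, q \in Qs -> f q <= c) ->
  \sum_(q <- Qs) f q <= K * c.
Proof.
move=> fc; rewrite -sum_size_const big_seq [leRHS]big_seq; exact: ler_sum.
Qed.

Lemma norm_sum_Qs_le (f : nat -> R) c : (forall q, q \in Qs -> `|f q| <= c) ->
  `|\sum_(q <- Qs) f q| <= K * c.
Proof.
by move=> fc; apply: le_trans (ler_norm_sum _ _ _) _; apply: sum_Qs_le.
Qed.

Lemma weight0 : w 0 = 0.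
Proof.
rewrite /w big_seq big1 // => q qQ.
by apply: ap_kernel_dvd; rewrite ?prime_gt0 ?Qs_prime ?Qs_ndvd.
Qed.

Lemma weight_norm_le m : `|w m| <= K * T%:R ^+ 2.
Proof.
apply: norm_sum_Qs_le => q qQ; apply: le_trans (ap_kernel_norm_sq _ _ _ (Qs_prime qQ)) _.
by rewrite natrX lerXn2r ?nnegrE // ler_nat Qs_le.
Qed.

Lemma weight_sum_le d X : `|\sum_(x < X) w (d * x)%N| <= K * T%:R ^+ 4.
Proof.
rewrite exchange_big /=; apply: norm_sum_Qs_le => q qQ.
apply: le_trans (ap_kernel_sum_le _ _ _ (Qs_prime qQ) (Qs_ndvd qQ)) _.
by rewrite natrX lerXn2r ?nnegrE // ler_nat Qs_le.
Qed.

(** The K ^ 2 pairs of distinct primes only contribute boundary terms; the main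
    contribution comes from the K diagonal pairs. *)
Lemma weight_corr_le e e' X :
  `|\sum_(x < X) x%:R * (w (e * x)%N * w (e' * x)%N)| <=
  2 * X%:R * (K ^+ 2 * T%:R ^+ 8) + X%:R * \sum_(q <- Qs)
    ((X%:R + (q ^ 2)%:R) * ((q ^ 2)%:R * (e == e' %[mod q ^ 2])%:R + 2) + X%:R).
Proof.
pose D q : R := (X%:R + (q ^ 2)%:R) * ((q ^ 2)%:R * (e == e' %[mod q ^ 2])%:R + 2) + X%:R.
have D0 q : 0 <= D q by rewrite /D !(addr_ge0, mulr_ge0).
have -> : \sum_(x < X) x%:R * (w (e * x)%N * w (e' * x)%N) =
  \sum_(q <- Qs) \sum_(q' <- Qs) \sum_(x < X) x%:R * (ker q n (e * x) * ker q' n (e' * x)).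
  under [RHS]eq_bigr do rewrite exchange_big /=.
  rewrite [RHS]exchange_big /=; apply: eq_bigr => x _.
  rewrite /w mulr_suml mulr_sumr; apply: eq_bigr => q _.
  by rewrite !mulr_sumr.
have H q q' : q \in Qs -> q' \in Qs ->
  `|\sum_(x < X) x%:R * (ker q n (e * x) * ker q' n (e' * x))| <=
  2 * X%:R * T%:R ^+ 8 + (if q' == q then X%:R * D q else 0).
  move=> qQ q'Q; have [->|qq'] := eqVneq q' q.
    apply: (@le_trans _ _ (X%:R * D q)); last by rewrite lerDr !mulr_ge0 ?exprn_ge0.
    apply: le_trans (ler_norm_sum _ _ _) _.
    apply: le_trans (_ : _ <= X%:R * \sum_(x < X) (`|ker q n (e * x)| * `|ker q n (e' * x)|)) _.
      rewrite mulr_sumr; apply: ler_sum => x _; rewrite !normrM ger0_norm //.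
      by rewrite ler_wpM2r ?mulr_ge0 // ler_nat ltnW.
    by rewrite ler_wpM2l // ap_kernel_diag_le ?Qs_prime ?Qs_ndvd.
  rewrite addr0.
  apply: (@abel_sum_le _ (fun x => x%:R) (fun x => ker q n (e * x) * ker q' n (e' * x))).
  - by [].
  - by move=> x y; rewrite ler_nat.
  move=> x; apply: le_trans (ap_kernel_corr_le _ _ _ _ (Qs_prime qQ) (Qs_prime q'Q) _ (Qs_ndvd qQ) (Qs_ndvd q'Q)) _.
    by rewrite eq_sym.
  by rewrite -natrX ler_nat (expnM T 2 4) leq_exp2r // leq_mul ?Qs_le.
apply: (@le_trans _ _ (\sum_(q <- Qs) \sum_(q' <- Qs)
    (2 * X%:R * T%:R ^+ 8 + (if q' == q then X%:R * D q else 0)))).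
  apply: le_trans (ler_norm_sum _ _ _) _.
  rewrite big_seq [leRHS]big_seq; apply: ler_sum => q qQ.
  apply: le_trans (ler_norm_sum _ _ _) _.
  by rewrite big_seq [leRHS]big_seq; apply: ler_sum => q' q'Q; apply: H.
under eq_bigr do rewrite big_split /= sum_size_const.
rewrite big_split /= sum_size_const mulr_sumr.
have -> : \sum_(q <- Qs) \sum_(q' <- Qs) (if q' == q then X%:R * D q else 0) =
    \sum_(q <- Qs) X%:R * D q.
  rewrite big_seq [RHS]big_seq; apply: eq_bigr => q qQ.
  rewrite (bigD1_seq q) //= eqxx big1 ?addr0 // => q'.
  by move=> /negbTE ->.
by rewrite lerD2r le_eqVlt; apply/orP; left; apply/eqP; ring.
Qed.

(** Truncation encodes the condition e h < n of the bilinear sums. *)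
Definition cut_weight m : R := if (m < n)%N then w m else 0.

Lemma cut_weight_ge m : (n <= m)%N -> cut_weight m = 0.
Proof. by rewrite /cut_weight leqNgt => /negbTE ->. Qed.

Lemma cut_weight0 : cut_weight 0 = 0.
Proof. by rewrite /cut_weight weight0 if_same. Qed.

Lemma sum_cut_weight (f : nat -> R) d : (0 < n)%N -> (0 < d)%N ->
  \sum_(k < n) f k * cut_weight (d * k) = \sum_(k < (n.-1 %/ d).+1) f k * w (d * k).
Proof.
move=> n0 d0; rewrite -(sum_truncated (fun k => f k * w (d * k))) //.
by rewrite [RHS]big_mkcond; apply: eq_bigr => k _; rewrite /cut_weight; case: ifP; rewrite ?mulr0.
Qed.

Lemma size_multiples_le m : (0 < m <= n)%N -> ((n.-1 %/ m).+1)%:R <= 2 * (n%:R / m%:R) :> R.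
Proof.
move=> /andP[m0 mn]; have mp : 0 < m%:R :> R by rewrite ltr0n.
rewrite mulrA ler_pdivlMr // -natrM -natrM ler_nat mulSn.
have := leq_trunc_div n.-1 m; lia.
Qed.

(** With m = max(e, e'), the variable h ranges up to about n / m. The first
    summand collects the pairs q <> q', the second one the pairs q = q'. *)
Definition corr_bound (e e' : nat) : R :=
  let m := maxn e e' in
  4 * K ^+ 2 * T%:R ^+ 8 * (n%:R / m%:R) +
  (n%:R / m%:R) ^+ 2 * \sum_(q <- Qs) (6 * (q ^ 2)%:R * (e == e' %[mod q ^ 2])%:R + 16).

(** The condition on the maximum ensures that the range of h is longer than
    all the periods q ^ 2. *)
Lemma cut_weight_corr_le e e' : (0 < n)%N -> (0 < e)%N -> (0 < e')%N -> (maxn e e' * T ^ 2 <= n)%N ->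
  (0 < T)%N ->
  `|\sum_(h < n) h%:R * (cut_weight (e * h) * cut_weight (e' * h))| <= corr_bound e e'.
Proof.
move=> n0 e0 e0' mT T0; rewrite /corr_bound /=.
set m := maxn e e' in mT *.
have m0 : (0 < m)%N by rewrite leq_max e0.
have mn : (m <= n)%N by apply: leq_trans mT; rewrite leq_pmulr // expn_gt0 T0.
have -> : \sum_(h < n) h%:R * (cut_weight (e * h) * cut_weight (e' * h)) =
   \sum_(h < (n.-1 %/ m).+1) h%:R * (w (e * h) * w (e' * h)).
  rewrite -(sum_truncated (fun h => h%:R * (w (e * h) * w (e' * h)))) //.
  rewrite [RHS]big_mkcond; apply: eq_bigr => h _.
  rewrite /cut_weight /m maxnMl gtn_max.
  by case: ifP; case: ifP; rewrite ?mulr0 ?mul0r ?mulr0.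
apply: le_trans (weight_corr_le _ _ _) _.
have X2 := size_multiples_le (m := m); rewrite m0 mn in X2.
have {X2} := X2 isT; move: (_.+1)%:R (ler0n R (n.-1 %/ m).+1) => X X0 X2.
have Y : (T ^ 2)%:R <= n%:R / m%:R :> R.
  by rewrite ler_pdivlMr ?ltr0n // -natrM ler_nat mulnC.
have Y0 : 0 <= n%:R / m%:R :> R by rewrite divr_ge0.
move: (n%:R / m%:R) Y0 Y X2 => y y0 Ty X2.
apply: lerD.
  have c0 : 0 <= K ^+ 2 * T%:R ^+ 8 by rewrite mulr_ge0 ?exprn_ge0.
  rewrite -(mulrA 4 (K ^+ 2)); move: (K ^+ 2 * _) c0 => c c0; nra.
rewrite !mulr_sumr big_seq [leRHS]big_seq; apply: ler_sum => q qQ.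
have Pq : (q ^ 2)%:R <= y.
  by apply: le_trans Ty; rewrite ler_nat leq_exp2r // Qs_le.
move: ((q ^ 2)%:R : R) (ler0n R (q ^ 2)) Pq => P P0 Py.
have XX : X * (X + P) <= 6 * y ^+ 2.
  by apply: le_trans (ler_pM _ _ X2 (lerD X2 Py)) _; rewrite ?addr_ge0 //; nra.
have X3 : X * X <= 4 * y ^+ 2.
  by apply: le_trans (ler_pM _ _ X2 X2) _ => //; nra.
case: (_ == _); rewrite /= ?mulr1 ?mulr0; last by nra.
rewrite mulrDr mulrA.
have : X * (X + P) * (P + 2) <= 6 * y ^+ 2 * (P + 2) by rewrite ler_wpM2r // addr_ge0.
lra.
Qed.

Lemma corr_bound_ge0 e e' : 0 <= corr_bound e e'.
Proof.
rewrite /corr_bound /=; set y := n%:R / _.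
have : 0 <= y by rewrite divr_ge0.
move: y => y y0; apply: addr_ge0; first by rewrite !mulr_ge0 ?exprn_ge0.
by rewrite mulr_ge0 ?sqr_ge0 //; apply: sumr_ge0 => q _; rewrite addr_ge0 // !mulr_ge0.
Qed.

Lemma corr_boundC e e' : corr_bound e e' = corr_bound e' e.
Proof.
rewrite /corr_bound maxnC; congr (_ + _ * _); apply: eq_bigr => q _.
by rewrite eq_sym.
Qed.

(** Since e' exceeds all the q ^ 2, only O(e' / q ^ 2) of the e <= e' are
    congruent to e' modulo q ^ 2, which compensates the factor q ^ 2. *)
Lemma sum_corr_bound_row_le e' : (T ^ 2 < e')%N ->
  \sum_(e < e'.+1 | (T ^ 2 < e)%N) corr_bound e e' <=
  8 * K ^+ 2 * T%:R ^+ 8 * n%:R + 50 * K * n%:R ^+ 2 * e'%:R^-1.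
Proof.
move=> Te.
have e0 : (0 < e')%N by apply: leq_ltn_trans Te.
have ep : 0 < e'%:R :> R by rewrite ltr0n.
apply: (@le_trans _ _ (\sum_(e < e'.+1) corr_bound e e')).
  by rewrite big_mkcond; apply: ler_sum => e _; case: ifP => // _; apply: corr_bound_ge0.
have -> : \sum_(e < e'.+1) corr_bound e e' =
  \sum_(e < e'.+1) (4 * K ^+ 2 * T%:R ^+ 8 * (n%:R / e'%:R) +
  (n%:R / e'%:R) ^+ 2 * \sum_(q <- Qs) (6 * (q ^ 2)%:R * (e == e' %[mod q ^ 2])%:R + 16)).
  apply: eq_bigr => e _; rewrite /corr_bound.
  by have /maxn_idPr -> : (e <= e')%N by rewrite -ltnS.
have e1 : 1 <= e'%:R :> R by rewrite ler1n.
have S1 : e'.+1%:R <= 2 * e'%:R :> R by rewrite -natr1; lra.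
rewrite big_split /= sumr_const card_ord -mulr_sumr; apply: lerD.
  rewrite -[leLHS]mulr_natl.
  have -> : 8 * K ^+ 2 * T%:R ^+ 8 * n%:R =
     (2 * e'%:R) * (4 * K ^+ 2 * T%:R ^+ 8 * (n%:R / e'%:R)).
    by field; rewrite gt_eqF.
  by rewrite ler_wpM2r // !mulr_ge0 ?exprn_ge0 ?invr_ge0.
have -> : 50 * K * n%:R ^+ 2 * e'%:R^-1 = (n%:R / e'%:R) ^+ 2 * (K * (50 * e'%:R)).
  by field; rewrite gt_eqF.
rewrite ler_wpM2l ?sqr_ge0 // exchange_big /=.
apply: sum_Qs_le => q qQ.
have q0 : (0 < q ^ 2)%N by rewrite expn_gt0 prime_gt0 ?Qs_prime.
have Pp : 0 < (q ^ 2)%:R :> R by rewrite ltr0n.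
rewrite big_split /= -mulr_sumr sumr_const card_ord -[16 *+ _]mulr_natl.
have : \sum_(e < e'.+1) (e == e' %[mod q ^ 2])%:R <= e'.+1%:R / (q ^ 2)%:R + 1 :> R.
  apply: (sum_congruent_le _ (A := fun e => (e == e' %[mod q ^ 2])%N)) => //.
  by move=> x y /eqP -> /eqP ->.
have Pe : (q ^ 2)%:R <= e'%:R :> R.
  by rewrite ler_nat; apply: leq_trans (ltnW Te); rewrite leq_exp2r // Qs_le.
rewrite -(ler_pM2l (_ : 0 < 6 * (q ^ 2)%:R)) ?mulr_gt0 //.
have -> : 6 * (q ^ 2)%:R * (e'.+1%:R / (q ^ 2)%:R + 1) = 6 * e'.+1%:R + 6 * (q ^ 2)%:R :> R.
  by move: (q ^ 2)%:R e'.+1%:R Pp => P X Pp; field; rewrite gt_eqF.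
move: S1 Pe; lra.
Qed.

Lemma sum_sym_le (B : nat -> nat -> R) (P : pred nat) M :
  (forall x y, 0 <= B x y) -> (forall x y, B x y = B y x) ->
  \sum_(x < M | P x) \sum_(y < M | P y) B x y <=
  2 * \sum_(y < M | P y) \sum_(x < y.+1 | P x) B x y.
Proof.
move=> B0 BC.
have E (y : 'I_M) : \sum_(x < y.+1 | P x) B x y =
    \sum_(x < M | P x) (if (x <= y)%N then B x y else 0).
  by rewrite (big_ord_widen_cond _ P (fun x => B x y) (ltn_ord y)) big_mkcondr.
under [X in _ <= 2 * X]eq_bigr do rewrite E.
rewrite mulr_natl mulr2n [X in _ <= X + _]exchange_big /= -big_split /=.
apply: ler_sum => x Px; rewrite -big_split /=; apply: ler_sum => y Py.
have := B0 x y; rewrite (BC y x).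
by case/orP: (leq_total x y) => ->; case: ifP => _; lra.
Qed.

Lemma sum_corr_bound_le E :
  \sum_(e < E.+1 | (T ^ 2 < e)%N) \sum_(e' < E.+1 | (T ^ 2 < e')%N) corr_bound e e' <=
  16 * K ^+ 2 * T%:R ^+ 8 * n%:R * E%:R + 100 * K * n%:R ^+ 2 * harmonic_sum R E.+1.
Proof.
apply: le_trans (sum_sym_le _ _ corr_bound_ge0 corr_boundC) _.
have c0 : 0 <= 8 * K ^+ 2 * T%:R ^+ 8 * n%:R by rewrite !mulr_ge0 ?exprn_ge0.
have d0 : 0 <= 50 * K * n%:R ^+ 2 by rewrite !mulr_ge0 ?exprn_ge0.
have -> : 16 * K ^+ 2 * T%:R ^+ 8 * n%:R * E%:R + 100 * K * n%:R ^+ 2 * harmonic_sum R E.+1 =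
  2 * (E%:R * (8 * K ^+ 2 * T%:R ^+ 8 * n%:R) + 50 * K * n%:R ^+ 2 * harmonic_sum R E.+1).
  by ring.
rewrite ler_pM2l // big_mkcond big_ord_recl /= add0r.
rewrite /harmonic_sum [X in _ <= _ + _ * X]big_ord_recl invr0 add0r.
rewrite mulr_sumr.
apply: (@le_trans _ _ (\sum_(i < E) (8 * K ^+ 2 * T%:R ^+ 8 * n%:R +
   50 * K * n%:R ^+ 2 * (lift ord0 i)%:R^-1))); last first.
  by rewrite big_split /= sumr_const card_ord -[_ *+ E]mulr_natl.
apply: ler_sum => i _; case: ifP => Ti; last by rewrite addr_ge0 // mulr_ge0 ?invr_ge0.
exact: sum_corr_bound_row_le.
Qed.

(** Cauchy-Schwarz with weights 1 / h for g and h for the inner sums: the first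
    factor is then a power of a logarithm, and the second one is expanded and
    bounded through the correlations. *)
Lemma bilinear_le (lam g : nat -> R) V E t : (0 < n)%N -> (1 < T)%N ->
  (E * T ^ 2 <= n)%N ->
  (forall e, (e < n)%N -> 0 <= lam e <= t) -> (forall h, `|g h| <= (num_divisors h)%:R) ->
  (\sum_(h < n | (V < h)%N) g h *
     \sum_(e < E.+1 | (T ^ 2 < e)%N) lam e * cut_weight (e * h)) ^+ 2 <=
  harmonic_sum R n ^+ 4 * (t ^+ 2 * (16 * K ^+ 2 * T%:R ^+ 8 * n%:R * E%:R +
      100 * K * n%:R ^+ 2 * harmonic_sum R E.+1)).
Proof.
move=> n0 T1 ET lamt gt; pose S h := \sum_(e < E.+1 | (T ^ 2 < e)%N) lam e * cut_weight (e * h).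
rewrite -[X in X ^+ 2 <= _]/(\sum_(h < n | (V < h)%N) g h * S h).
apply: le_trans (cauchy_schwarz_weighted (c := fun h : 'I_n => h%:R) _ _ _) _.
  by move=> h Vh; rewrite ltr0n; apply: leq_ltn_trans Vh.
apply: ler_pM.
- by apply: sumr_ge0 => h _; rewrite divr_ge0 ?sqr_ge0.
- by apply: sumr_ge0 => h _; rewrite mulr_ge0 ?sqr_ge0.
- apply: le_trans (sum_num_divisors_sq_le R n).
  rewrite big_mkcond; apply: ler_sum => h _; case: ifP => _; last by rewrite divr_ge0 ?exprn_ge0.
  by rewrite ler_wpM2r ?invr_ge0 // -[leLHS]real_normK ?num_real // lerXn2r ?nnegrE.
apply: (@le_trans _ _ (\sum_(h < n) h%:R * S h ^+ 2)).
  by rewrite big_mkcond; apply: ler_sum => h _; case: ifP => // _; rewrite mulr_ge0 ?sqr_ge0.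
have -> : \sum_(h < n) h%:R * S h ^+ 2 =
   \sum_(e < E.+1 | (T ^ 2 < e)%N) \sum_(e' < E.+1 | (T ^ 2 < e')%N) lam e * lam e' *
     \sum_(h < n) h%:R * (cut_weight (e * h) * cut_weight (e' * h)).
  transitivity (\sum_(h < n) \sum_(e < E.+1 | (T ^ 2 < e)%N)
     \sum_(e' < E.+1 | (T ^ 2 < e')%N) lam e * lam e' * (h%:R * (cut_weight (e * h) * cut_weight (e' * h)))).
    apply: eq_bigr => h _; rewrite expr2 {1}/S mulr_suml mulr_sumr; apply: eq_bigr => e _.
    by rewrite /S !mulr_sumr; apply: eq_bigr => e' _; ring.
  rewrite exchange_big /=; apply: eq_bigr => e _.
  by rewrite exchange_big /=; apply: eq_bigr => e' _; rewrite mulr_sumr.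
apply: le_trans (_ : _ <= t ^+ 2 * (\sum_(e < E.+1 | (T ^ 2 < e)%N)
     \sum_(e' < E.+1 | (T ^ 2 < e')%N) corr_bound e e')) _; last first.
  by rewrite ler_wpM2l ?sqr_ge0 // sum_corr_bound_le.
rewrite mulr_sumr; apply: ler_sum => e Te; rewrite mulr_sumr; apply: ler_sum => e' Te'.
have En : (E < n)%N.
  have [->//|E0] := posnP E; apply: leq_trans ET.
  by rewrite ltn_Pmulr // -{1}(exp1n 2) ltn_exp2r.
have eP (x : 'I_E.+1) : (T ^ 2 < x)%N -> [/\ (0 < x)%N, (x <= E)%N & 0 <= lam x <= t].
  move=> Tx; have xE : (x <= E)%N by rewrite -ltnS.
  by rewrite (leq_ltn_trans _ Tx) //; split=> //; apply: lamt; apply: leq_ltn_trans En.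
have [e0 eE /andP[l0 lt]] := eP e Te; have [e'0 e'E /andP[l0' lt']] := eP e' Te'.
have t0 : 0 <= t := le_trans l0 lt.
apply: le_trans (ler_norm _) _; rewrite normrM ger0_norm ?mulr_ge0 //.
apply: ler_pM; rewrite ?mulr_ge0 //; first by rewrite expr2 ler_pM.
apply: cut_weight_corr_le => //; last exact: ltnW.
by apply: leq_trans ET; rewrite leq_mul2r geq_max eE e'E orbT.
Qed.

End Weight.

(** * Vaughan's identity *)

Section TruncMu.
Variable R : realFieldType.

Definition moebius_upto V h : R := \sum_(d <- divisors h | (d <= V)%N) moebius R d.

Lemma moebius_upto_norm_le V h : `|moebius_upto V h| <= (num_divisors h)%:R.
Proof.
apply: le_trans (ler_norm_sum _ _ _) _.
rewrite /num_divisors -sum1_size natr_sum big_mkcond; apply: ler_sum => d _.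
by case: ifP => // _; apply: moebius_norm_le.
Qed.

Lemma moebius_uptoE V h : (0 < h)%N ->
  moebius_upto V h = \sum_(d < V.+1 | (0 < d)%N && (d %| h)%N) moebius R d.
Proof.
move=> h0; rewrite /moebius_upto -big_filter.
rewrite -(big_mkord (fun d => (0 < d)%N && (d %| h)%N)) -[RHS]big_filter.
apply/perm_big/uniq_perm; rewrite ?filter_uniq ?divisors_uniq ?iota_uniq //.
move=> d; rewrite !mem_filter mem_index_iota -dvdn_divisors //= ltnS.
by case: (boolP (d %| h)%N) => [/(dvdn_gt0 h0) ->|]; rewrite ?andbF ?andbT.
Qed.

(** For h <= V no divisor is lost, hence Moebius inversion applies. *)
Lemma moebius_upto_small V h : (0 < h <= V)%N -> moebius_upto V h = (h == 1%N)%:R.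
Proof.
move=> /andP[h0 hV]; rewrite moebius_uptoE // -(@sum_moebius R V.+1) ?h0 //.
apply: eq_bigl => d; case: (boolP (d %| h)%N); rewrite ?andbF // andbT.
by move/(dvdn_gt0 h0).
Qed.
End TruncMu.

Section Vaughan.
Variables (R : realFieldType) (lg : nat -> R).
Hypothesis lgM : forall a b, (0 < a)%N -> (0 < b)%N -> lg (a * b) = lg a + lg b.
Hypothesis lg_mono : {homo lg : x y / (x <= y)%N >-> x <= y}.
Hypothesis lg0 : lg 0 = 0.
Hypothesis lg2 : lg 2 = 1.
Local Notation Lam := (vonMangoldt lg).

Variables (n : nat) (C : nat -> R).
Hypothesis C0 : C 0 = 0.
Hypothesis Cn : forall m, (n <= m)%N -> C m = 0.

Lemma Cn_mul e h : (0 < e)%N -> (n <= h)%N -> C (e * h) = 0.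
Proof. by move=> e0 nh; apply: Cn; apply: leq_trans nh _; rewrite leq_pmull. Qed.

Lemma sum_moebius_upto V e : (0 < e)%N ->
  \sum_(h < n) moebius_upto R V h * C (e * h) =
  \sum_(d < V.+1 | (0 < d)%N) moebius R d * \sum_(k < n) C (e * (d * k)).
Proof.
move=> e0.
transitivity (\sum_(h < n) \sum_(d < V.+1 | (0 < d)%N && (d %| h)%N) moebius R d * C (e * h)).
  apply: eq_bigr => h _; have [->|h0] := posnP h.
    by rewrite muln0 C0 mulr0 big1 // => d _; rewrite mulr0.
  by rewrite moebius_uptoE // mulr_suml.
rewrite (exchange_big_dep (fun d : 'I_V.+1 => (0 < d)%N)) /=; last by move=> h d _ /andP[].
apply: eq_bigr => d d0; rewrite -mulr_sumr d0 /=; congr (_ * _).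
by rewrite -(sum_multiples (f := fun h => C (e * h))) // => h; apply: Cn_mul.
Qed.

Lemma sum_moebius_upto_split V e : (1 < n)%N -> (0 < V)%N ->
  \sum_(h < n) moebius_upto R V h * C (e * h) =
  C e + \sum_(h < n | (V < h)%N) moebius_upto R V h * C (e * h).
Proof.
move=> n1 V0; rewrite (bigID (fun h : 'I_n => (V < h)%N)) /= addrC; congr (_ + _).
rewrite (bigD1 (Ordinal n1)) /= -?leqNgt // moebius_upto_small // mul1r muln1 big1 ?addr0 //.
move=> h /andP[]; rewrite -leqNgt -val_eqE /= => hV h1.
have [->|h0] := posnP h; first by rewrite muln0 C0 mulr0.
by rewrite moebius_upto_small ?h0 // (negbTE h1) mul0r.
Qed.

Lemma vonMangoldt0 : Lam 0 = 0.
Proof.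
apply/eqP; rewrite eq_le (vonMangoldt_ge0 lg_mono lg0) andbT -lg0.
exact: (vonMangoldt_le lgM lg_mono lg0).
Qed.

(** This is the identity 1 * Lambda = log, summed against C on multiples of
    d. *)
Lemma sum_vonMangoldt_conv d : (0 < d)%N ->
  \sum_(e < n) Lam e * \sum_(k < n) C (d * (e * k)) = \sum_(m < n) lg m * C (d * m).
Proof.
move=> d0.
transitivity (\sum_(e < n) \sum_(m < n | (e %| m)%N) Lam e * C (d * m)).
  apply: eq_bigr => e _; rewrite -mulr_sumr.
  have [->|e0] := posnP e; first by rewrite vonMangoldt0 !mul0r.
  congr (_ * _); rewrite (sum_multiples (f := fun m => C (d * m))) //.
  by move=> h; apply: Cn_mul.
rewrite (exchange_big_dep xpredT) //=; apply: eq_bigr => m _; rewrite -mulr_suml.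
have [->|m0] := posnP m; first by rewrite muln0 C0 !mulr0.
by rewrite (vonMangoldt_divisors lgM) ?m0 ?ltn_ord.
Qed.

(** Convolve Lambda with c = (moebius restricted to [1, V]) * 1, which is 1 at 1
    and vanishes on ]1, V]. On the one hand Lambda * c equals log convolved with
    the restricted moebius; on the other hand it is Lambda plus terms with
    h > V. Of these, those with e <= U are again sums over multiples, and those
    with e > U form the bilinear part, in which e V < n. *)
Lemma vaughan U V : (1 < n)%N -> (0 < V)%N ->
  \sum_(e < n) Lam e * C e =
    \sum_(d < V.+1 | (0 < d)%N) moebius R d * (\sum_(m < n) lg m * C (d * m))
  - \sum_(e < n | (0 < e <= U)%N) Lam e *
      (\sum_(d < V.+1 | (0 < d)%N) moebius R d * (\sum_(k < n) C (e * (d * k))) - C e)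
  - \sum_(h < n | (V < h)%N) moebius_upto R V h *
      \sum_(e < (n %/ V.+1).+1 | (U < e)%N) Lam e * C (e * h).
Proof.
move=> n1 V0.
pose H e := \sum_(h < n | (V < h)%N) moebius_upto R V h * C (e * h).
pose G e := \sum_(d < V.+1 | (0 < d)%N) moebius R d * (\sum_(k < n) C (e * (d * k))).
have GH e : (0 < e)%N -> G e = C e + H e.
  by move=> e0; rewrite -sum_moebius_upto_split // sum_moebius_upto.
have -> : \sum_(d < V.+1 | (0 < d)%N) moebius R d * (\sum_(m < n) lg m * C (d * m)) =
    \sum_(e < n) Lam e * G e.
  under [RHS]eq_bigr do rewrite mulr_sumr.
  rewrite exchange_big /=; apply: eq_bigr => d d0.
  rewrite -(sum_vonMangoldt_conv d0) mulr_sumr; apply: eq_bigr => e _.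
  by rewrite mulrCA; congr (_ * (_ * _)); apply: eq_bigr => k _; rewrite mulnCA.
have -> : \sum_(h < n | (V < h)%N) moebius_upto R V h *
      \sum_(e < (n %/ V.+1).+1 | (U < e)%N) Lam e * C (e * h) =
    \sum_(e < n | (U < e)%N) Lam e * H e.
  under [RHS]eq_bigr do rewrite mulr_sumr.
  rewrite [RHS]exchange_big /=; apply: eq_bigr => h Vh.
  rewrite mulr_sumr.
  rewrite -(@sum_ord_extend _ (n %/ V.+1).+1 n (fun e => (U < e)%N)
     (fun e => moebius_upto R V h * (Lam e * C (e * h)))).
  - by apply: eq_bigr => e _; rewrite mulrCA.
  - by apply: leq_ltn_trans (ltn_Pdiv _ _) => //; lia.
  move=> e; rewrite ltn_divLR // => ne _.
  rewrite Cn ?mulr0 //; apply: leq_trans (ltnW ne) _; by rewrite leq_mul2l Vh orbT.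
have -> : \sum_(e < n) Lam e * C e = \sum_(e < n) Lam e * G e - \sum_(e < n) Lam e * H e.
  rewrite -sumrB; apply: eq_bigr => e _; rewrite -mulrBr.
  have [->|e0] := posnP e; first by rewrite vonMangoldt0 !mul0r.
  by rewrite GH // addrK.
rewrite -addrA; congr (_ + _); rewrite -opprD; congr (- _).
rewrite (bigID (fun e : 'I_n => (U < e)%N)) /= addrC; congr (_ + _).
rewrite [LHS]big_mkcond [RHS]big_mkcond; apply: eq_bigr => e _ /=; rewrite -leqNgt.
have [->|e0] := posnP e; first by rewrite vonMangoldt0 !mul0r; case: (_ <= U)%N.
by case: ifP => // _; rewrite -/(G e) GH // addrAC subrr add0r.
Qed.

End Vaughan.

(** * The contradiction *)

Lemma sum_const_pred_le (R : realFieldType) n (P : pred nat) (c : R) : 0 <= c ->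
  \sum_(k < n | P k) c <= n%:R * c.
Proof.
move=> c0; apply: (@le_trans _ _ (\sum_(k < n) c)).
  by rewrite big_mkcond; apply: ler_sum => k _; case: ifP.
by rewrite sumr_const card_ord mulr_natl.
Qed.

(** Here x and N stand for T and n, while t bounds log n, and P = A - B - S is
    Vaughan's identity. As P <= - K N / 8 while A and B are at most K N / 64, S
    is at least K N / 16. Then the bound on S forces K = O(t ^ 7), which the
    lower bound for K excludes. *)
Lemma numeric_contradiction (R : realFieldType) (K x t N E P A B S : R) :
  20 <= t -> t ^+ 13 <= x -> x ^+ 20 <= N -> 0 <= K -> K <= x -> 0 <= E ->
  x / 4 <= (K + t) * t ^+ 2 -> E * x ^+ 10 <= N ->
  P <= K * ((x ^+ 2 + 1) * ((2 * x) ^+ 10 * t ^+ 2) + t - N / 4) ->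
  `|A| <= (x ^+ 10 + 1) * (2 * t * (K * x ^+ 4)) ->
  `|B| <= (x ^+ 2 + 1) * (t * ((x ^+ 10 + 1) * (K * x ^+ 4) + K * x ^+ 2)) ->
  S ^+ 2 <= t ^+ 4 * (t ^+ 2 * (16 * K ^+ 2 * x ^+ 8 * N * E + 100 * K * N ^+ 2 * t)) ->
  P = A - B - S -> False.
Proof.
move=> t20 tx13 xN K0 Kx E0 Kge EN Ple Ale Ble Sle PE.
have t0 : 0 < t by lra.
have t1 : 1 <= t by lra.
have te j k : (j <= k)%N -> t ^+ j <= t ^+ k by move=> jk; apply: ler_weXn2l.
have tx : 600 * 200 * t ^+ 9 <= x.
  (* The surplus t ^ 4 absorbs all constants; the product is not evaluated
     because numerals are unary. *)
  apply: le_trans tx13; have -> : t ^+ 13 = t ^+ 4 * t ^+ 9 by ring.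
  rewrite ler_wpM2r ?exprn_ge0 ?(ltW t0) //.
  have : 20 ^+ 4 <= t ^+ 4 by rewrite lerXn2r ?nnegrE // ltW.
  have -> : (20 : R) ^+ 4 = 400 * 400 by ring.
  lra.
have tx1 : 600 * 200 * t <= x by have := te 1%N 9%N isT; lra.
have tx2 : 600 * 200 * t ^+ 2 <= x by have := te 2%N 9%N isT; lra.
have x1 : 1 <= x by lra.
have x0 : 0 < x by lra.
have xe j k : (j <= k)%N -> x ^+ j <= x ^+ k by move=> jk; apply: ler_weXn2l.
have xp k : 0 <= x ^+ k by rewrite exprn_ge0 // ltW.
have e2 := xe 0%N 2%N isT; have e10 := xe 0%N 10%N isT; rewrite !expr0 in e2 e10.
have N0 : 0 < N by apply: lt_le_trans xN; rewrite exprn_gt0.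
have xS k : x ^+ k.+1 = x * x ^+ k by rewrite exprS.
have big k : (k < 20)%N -> 200 * x ^+ k <= N.
  move=> k20; apply: le_trans xN; apply: le_trans (xe k.+1 20%N k20); rewrite xS.
  by rewrite ler_wpM2r //; lra.
have KN0 : 0 <= K * N by rewrite mulr_ge0 // ltW.
have P1 : P <= - (K * N / 8).
  apply: le_trans Ple _; have -> : - (K * N / 8) = K * (- (N / 8)) by ring.
  rewrite ler_wpM2l //.
  have : (x ^+ 2 + 1) * ((2 * x) ^+ 10 * t ^+ 2) <= x ^+ 13.
    apply: (@le_trans _ _ (2 * x ^+ 2 * ((2 * x) ^+ 10 * t ^+ 2))).
      by rewrite ler_wpM2r ?mulr_ge0 ?sqr_ge0 //; lra.
    have -> : 2 * x ^+ 2 * ((2 * x) ^+ 10 * t ^+ 2) = (2 * 2 ^+ 10 * t ^+ 2) * x ^+ 12 by ring.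
    have -> : (2 : R) ^+ 10 = 32 * 32 by ring.
    by rewrite [leRHS]xS ler_wpM2r //; have := sqr_ge0 t; lra.
  have := big 13%N isT; have := big 1%N isT; rewrite expr1.
  move: (_ * (_ ^+ 10 * _)) (x ^+ 13) => a b; clear -tx1 t20 x0 N0; lra.
have A1 : `|A| <= K * N / 64.
  apply: le_trans Ale _.
  apply: (@le_trans _ _ (2 * x ^+ 10 * (2 * t * (K * x ^+ 4)))).
    by rewrite ler_wpM2r ?mulr_ge0 //; lra.
  have -> : 2 * x ^+ 10 * (2 * t * (K * x ^+ 4)) = K * (4 * t * x ^+ 14) by ring.
  rewrite -[leRHS]mulrA ler_wpM2l //.
  have : 4 * t * x ^+ 14 <= x ^+ 15 by rewrite [leRHS]xS ler_wpM2r //; lra.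
  have := big 15%N isT; lra.
have B1 : `|B| <= K * N / 64.
  apply: le_trans Ble _.
  apply: (@le_trans _ _ (2 * x ^+ 2 * (t * (2 * x ^+ 10 * (K * x ^+ 4) + K * x ^+ 14)))).
    apply: ler_pM; rewrite ?addr_ge0 ?mulr_ge0 ?addr_ge0 ?mulr_ge0 //; try lra.
    rewrite ler_wpM2l ?(ltW t0) // lerD //; first by rewrite ler_wpM2r ?mulr_ge0 //; lra.
    by rewrite ler_wpM2l // xe.
  have -> : 2 * x ^+ 2 * (t * (2 * x ^+ 10 * (K * x ^+ 4) + K * x ^+ 14)) =
    K * (6 * t * x ^+ 16) by ring.
  rewrite -[leRHS]mulrA ler_wpM2l //.
  have : 6 * t * x ^+ 16 <= x ^+ 17 by rewrite [leRHS]xS ler_wpM2r //; lra.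
  have := big 17%N isT; lra.
have S1 : K * N / 16 <= S.
  move: A1 B1; rewrite !ler_norml => /andP[A1 _] /andP[_ B1].
  lra.
have S2 : (K * N / 16) ^+ 2 <= S ^+ 2.
  by rewrite lerXn2r ?nnegrE //; [rewrite divr_ge0 | apply: le_trans S1; rewrite divr_ge0].
have K1 : 1 <= K.
  rewrite leNgt; apply/negP => Klt.
  have : (K + t) * t ^+ 2 <= (1 + t) * t ^+ 2 by rewrite ler_wpM2r ?sqr_ge0 //; lra.
  have := te 2%N 9%N isT; have := te 3%N 9%N isT.
  have -> : (1 + t) * t ^+ 2 = t ^+ 2 + t ^+ 3 by ring.
  have : 0 < t ^+ 9 by rewrite exprn_gt0.
  lra.
have EN2 : 16 * K ^+ 2 * x ^+ 8 * N * E <= 16 * K * N ^+ 2 * t.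
  have -> : 16 * K ^+ 2 * x ^+ 8 * N * E = (16 * N) * (K ^+ 2 * x ^+ 8 * E) by ring.
  have -> : 16 * K * N ^+ 2 * t = (16 * N) * (K * t * N) by ring.
  rewrite ler_wpM2l ?mulr_ge0 ?(ltW N0) //.
  have K2 : K ^+ 2 * x ^+ 8 <= x ^+ 10.
    have -> : x ^+ 10 = x ^+ 2 * x ^+ 8 by ring.
    by rewrite ler_wpM2r // lerXn2r ?nnegrE // ltW.
  have : K ^+ 2 * x ^+ 8 * E <= x ^+ 10 * E by rewrite ler_wpM2r.
  have Kt : 1 <= K * t by rewrite -[1]mulr1 ler_pM.
  have : N <= K * t * N by rewrite ler_peMl // ltW.
  lra.
have S3 : (K * N / 16) ^+ 2 <= 116 * t ^+ 7 * K * N ^+ 2.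
  apply: le_trans S2 _; apply: le_trans Sle _.
  have -> : 116 * t ^+ 7 * K * N ^+ 2 =
    t ^+ 4 * (t ^+ 2 * (16 * K * N ^+ 2 * t + 100 * K * N ^+ 2 * t)) by ring.
  by rewrite ler_wpM2l ?exprn_ge0 ?(ltW t0) // ler_wpM2l ?sqr_ge0 // lerD2r.
have K3 : K <= 256 * 116 * t ^+ 7.
  have c0 : 0 < K * N ^+ 2 by rewrite mulr_gt0 ?exprn_gt0 //; lra.
  rewrite -(ler_pM2r c0).
  have -> : 256 * 116 * t ^+ 7 * (K * N ^+ 2) = 256 * (116 * t ^+ 7 * K * N ^+ 2) by ring.
  have -> : K * (K * N ^+ 2) = 256 * (K * N / 16) ^+ 2 by field.
  lra.
have : (K + t) * t ^+ 2 <= (256 * 116 * t ^+ 7 + t ^+ 7) * t ^+ 2.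
  rewrite ler_wpM2r ?sqr_ge0 // lerD //; exact: (te 1%N 7%N).
have -> : (256 * 116 * t ^+ 7 + t ^+ 7) * t ^+ 2 = (256 * 116 + 1) * t ^+ 9 by ring.
have : 0 < t ^+ 9 by rewrite exprn_gt0.
lra.
Qed.

Section Final.
Variables (R : realFieldType) (lg : nat -> R).
Hypothesis lgM : forall a b, (0 < a)%N -> (0 < b)%N -> lg (a * b) = lg a + lg b.
Hypothesis lg_mono : {homo lg : x y / (x <= y)%N >-> x <= y}.
Hypothesis lg0 : lg 0 = 0.
Hypothesis lg2 : lg 2 = 1.
Local Notation Lam := (vonMangoldt lg).

Let Lam_ge0 e : 0 <= Lam e := vonMangoldt_ge0 lg_mono lg0 e.
Let Lam_le e : Lam e <= lg e := vonMangoldt_le lgM lg_mono lg0 e.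

Lemma psi_ge n : (4 <= n)%N -> n%:R / 4 <= \sum_(e < n) Lam e.
Proof.
move=> n4; set M := (n.-1)./2.
have Mn : ((M.*2).+1 <= n)%N by rewrite /M; lia.
apply: (@le_trans _ _ M%:R).
  by rewrite ler_pdivrMr // -natrM ler_nat /M; lia.
apply: le_trans (chebyshev lgM lg_mono lg0 lg2 M) _.
rewrite (big_ord_widen _ _ Mn) big_mkcond; apply: ler_sum => e _.
by case: ifP.
Qed.

Section TypeI.
Variables (n T t : nat) (Qs : seq nat).
Hypothesis Qs_prime : forall q, q \in Qs -> prime q.
Hypothesis Qs_ndvd : forall q, q \in Qs -> ~~ (q %| n)%N.
Hypothesis Qs_le : forall q, q \in Qs -> (q <= T)%N.
Hypothesis n1 : (1 < n)%N.
Hypothesis nt : (n <= 2 ^ t)%N.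
Let K : R := (size Qs)%:R.
Local Notation cut_weight := (cut_weight R n Qs).

Lemma lg_le_t e : (e <= n)%N -> lg e <= t%:R.
Proof. by move=> en; apply: (lg_le lgM lg_mono lg2); apply: leq_trans nt. Qed.

Lemma cut_weight_norm_le m : `|cut_weight m| <= K * T%:R ^+ 2.
Proof.
rewrite /cut_weight; case: ifP => _; first exact: weight_norm_le.
by rewrite normr0 mulr_ge0 ?exprn_ge0.
Qed.

Lemma type_I_log_le d : (0 < d)%N ->
  `|\sum_(m < n) lg m * cut_weight (d * m)| <= 2 * t%:R * (K * T%:R ^+ 4).
Proof.
move=> d0; rewrite sum_cut_weight ?(ltnW n1) //.
apply: le_trans (abel_sum_le (f := fun m => weight R n Qs (d * m))
  (B := K * T%:R ^+ 4) _ _ lg_mono _) _.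
- by move=> x; rewrite (lg_ge0 lg_mono lg0).
- by move=> x; apply: weight_sum_le.
rewrite ler_wpM2r ?mulr_ge0 ?exprn_ge0 // ler_pM2l //; apply: lg_le_t.
by apply: leq_trans (_ : n.-1.+1 <= n)%N; rewrite ?ltnS ?leq_div // prednK // ltnW.
Qed.

Lemma type_I_le d : (0 < d)%N ->
  `|\sum_(m < n) cut_weight (d * m)| <= K * T%:R ^+ 4.
Proof.
move=> d0.
have -> : \sum_(m < n) cut_weight (d * m) = \sum_(m < n) (fun=> 1) m * cut_weight (d * m).
  by under [RHS]eq_bigr do rewrite mul1r.
rewrite (@sum_cut_weight R n Qs (fun=> 1) d) ?(ltnW n1) //; under eq_bigr do rewrite mul1r.
exact: weight_sum_le.
Qed.

(** Each inner sum runs over a progression of multiples of d, where the kernels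
    cancel. *)
Lemma type_I_log_sum_le V :
  `|\sum_(d < V.+1 | (0 < d)%N) moebius R d * (\sum_(m < n) lg m * cut_weight (d * m))| <=
  V.+1%:R * (2 * t%:R * (K * T%:R ^+ 4)).
Proof.
have c0 : 0 <= 2 * t%:R * (K * T%:R ^+ 4) by rewrite !mulr_ge0 ?exprn_ge0.
apply: le_trans (sum_const_pred_le _ (fun d => 0 < d)%N c0).
apply: le_trans (ler_norm_sum _ _ _) _; apply: ler_sum => d d0.
by rewrite normrM -[leRHS]mul1r ler_pM ?moebius_norm_le ?type_I_log_le.
Qed.

Lemma type_I_small_le U V :
  `|\sum_(e < n | (0 < e <= U)%N) Lam e *
      (\sum_(d < V.+1 | (0 < d)%N) moebius R d * (\sum_(k < n) cut_weight (e * (d * k))) - cut_weight e)| <=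
  U.+1%:R * (t%:R * (V.+1%:R * (K * T%:R ^+ 4) + K * T%:R ^+ 2)).
Proof.
have c0 : 0 <= K * T%:R ^+ 4 by rewrite !mulr_ge0 ?exprn_ge0.
have c2 : 0 <= K * T%:R ^+ 2 by rewrite !mulr_ge0 ?exprn_ge0.
set c := t%:R * _.
have c1 : 0 <= c by rewrite mulr_ge0 ?addr_ge0 ?mulr_ge0.
apply: le_trans (sum_const_lt_le n U.+1 c1).
apply: le_trans (ler_norm_sum _ _ _) _.
rewrite big_mkcond [leRHS]big_mkcond; apply: ler_sum => e _.
rewrite ltnS; case: posnP => [_|e0] /=; first by case: ifP.
case: ifP => // eU; rewrite normrM ger0_norm //; apply: ler_pM => //.
  by apply: le_trans (Lam_le _) _; apply: lg_le_t; apply: ltnW.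
apply: le_trans (ler_normB _ _) _; apply: lerD; last exact: cut_weight_norm_le.
apply: le_trans (sum_const_pred_le _ (fun d => 0 < d)%N c0).
apply: le_trans (ler_norm_sum _ _ _) _; apply: ler_sum => d d0.
rewrite normrM -[leRHS]mul1r ler_pM ?moebius_norm_le //.
under eq_bigr do rewrite mulnA.
by apply: type_I_le; rewrite muln_gt0 e0.
Qed.

(** No prime satisfies the congruence modulo q ^ 2, so that the first part of
    the kernel only sees proper prime powers, whose total mass is at most r. The
    second part misses only the powers of q, among them the prime q itself. *)
Lemma main_term_le r :
  (forall p q, prime p -> (p < n)%N -> q \in Qs -> ~~ (q ^ 2 %| n - p)%N) ->
  (4 <= n)%N -> (T < n)%N ->
  \sum_(e < n | ~~ prime e) Lam e <= r ->
  \sum_(e < n) Lam e * cut_weight e <= K * ((T%:R ^+ 2 + 1) * r + t%:R - n%:R / 4).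
Proof.
move=> no n4 Tn Rr.
have -> : \sum_(e < n) Lam e * cut_weight e = \sum_(q <- Qs) \sum_(e < n) Lam e * ap_kernel R q n e.
  rewrite exchange_big /=; apply: eq_bigr => e _.
  by rewrite /cut_weight ltn_ord /weight mulr_sumr.
apply: sum_Qs_le => q qQ; have qp := Qs_prime qQ.
have nonp (A : pred nat) : \sum_(e < n) Lam e * (~~ prime e && A e)%:R <= r.
  apply: le_trans Rr; rewrite [leRHS]big_mkcond; apply: ler_sum => e _.
  by case: (prime e); case: (A e); rewrite /= ?mulr1 ?mulr0.
have r0 : 0 <= r by apply: le_trans Rr; apply: sumr_ge0.
have H1 : \sum_(e < n) Lam e * (e == n %[mod q ^ 2])%:R <= r.
  apply: le_trans (nonp (fun e => e == n %[mod q ^ 2])%N); apply: ler_sum => e _.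
  case: (boolP (prime e)) => //= pe.
  suff /negbTE -> : (e != n %[mod q ^ 2])%N by rewrite mulr0.
  have := no _ _ pe (ltn_ord e) qQ; rewrite -eqn_mod_dvd 1?ltnW //.
  by rewrite eq_sym.
have H2 : \sum_(e < n) Lam e * (q %| e)%:R <= r + t%:R.
  have qn : (q < n)%N by apply: leq_ltn_trans Tn; apply: Qs_le.
  apply: (@le_trans _ _ (\sum_(e < n) (Lam e * (~~ prime e && (q %| e)%N)%:R +
      if e == q :> nat then t%:R else 0))).
    apply: ler_sum => e _.
    have i0 : 0 <= (if e == q :> nat then t%:R else 0) :> R by case: ifP.
    case: (boolP (prime e)) => //= pe; last by rewrite lerDl.
    rewrite mulr0 add0r dvdn_prime2 // eq_sym; case: eqP => [E|_]; last by rewrite mulr0.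
    by rewrite mulr1; apply: le_trans (Lam_le _) _; apply: lg_le_t; apply: ltnW.
  rewrite big_split /=; apply: lerD; first exact: (nonp (fun e => (q %| e)%N)).
  by rewrite -big_mkcond (big_ord1_eq _ (fun=> t%:R)) qn.
have H3 := psi_ge n4.
have -> : \sum_(e < n) Lam e * ap_kernel R q n e =
  (q * q.-1)%:R * \sum_(e < n) Lam e * (e == n %[mod q ^ 2])%:R
   - \sum_(e < n) Lam e + \sum_(e < n) Lam e * (q %| e)%:R.
  rewrite mulr_sumr -sumrB -big_split /=; apply: eq_bigr => e _.
  by rewrite /ap_kernel; case: (q %| e)%N => /=; ring.
have H4 : (q * q.-1)%:R * (\sum_(e < n) Lam e * (e == n %[mod q ^ 2])%:R) <= T%:R ^+ 2 * r.
  apply: ler_pM => //; first by apply: sumr_ge0 => e _; rewrite mulr_ge0.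
  rewrite -natrX ler_nat; apply: leq_mul; first exact: Qs_le.
  by apply: leq_trans (leq_pred _) _; exact: Qs_le.
lra.
Qed.

End TypeI.

(** The cut points of Vaughan's identity are U = T ^ 2 and V = T ^ 10: e > T ^ 2
    makes the diagonal count efficient, h > T ^ 10 absorbs the factor T ^ 8
    coming from the pairs of distinct primes, and T ^ 20 <= n leaves room for
    the sums over multiples. *)
Lemma exists_prime_square_shift n s : let t := (20 * s.+1)%N in let T := (2 ^ s)%N in
  (t ^ 13 <= T)%N -> (T ^ 20 <= n)%N -> (n <= 2 ^ t)%N ->
  exists p q, [/\ prime p, (p < n)%N, prime q & (q ^ 2 %| n - p)%N].
Proof.
move=> t T Tt Tn nt.
pose Qs := [seq q <- iota 0 T | prime q && ~~ (q %| n)%N].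
have QP q : q \in Qs -> [/\ prime q, ~~ (q %| n)%N & (q < T)%N].
  by rewrite mem_filter mem_iota /= add0n => /andP[/andP[? ?] ?].
have Qs_prime q : q \in Qs -> prime q by case/QP.
have Qs_ndvd q : q \in Qs -> ~~ (q %| n)%N by case/QP.
have Qs_le q : q \in Qs -> (q <= T)%N by case/QP => _ _ /ltnW.
have Qs_uniq : uniq Qs by rewrite filter_uniq ?iota_uniq.
have [/existsP[p /andP[pp /hasP[q qQ qp]]]|no] :=
  boolP [exists p : 'I_n, prime p && has (fun q => q ^ 2 %| n - p)%N Qs].
  by exists p, q; split=> //; apply: Qs_prime.
exfalso.
have {}no p q : prime p -> (p < n)%N -> q \in Qs -> ~~ (q ^ 2 %| n - p)%N.
  move=> pp pn qQ; apply: contra no => qp; apply/existsP; exists (Ordinal pn).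
  by rewrite /= pp; apply/hasP; exists q.
have t20 : (20 <= t)%N by rewrite /t; lia.
have tT : (t <= T)%N.
  by apply: leq_trans Tt; rewrite -{1}(expn1 t) leq_pexp2l //; lia.
have T16 : (16 <= T)%N by lia.
have TltTn : (T < T ^ 20)%N by rewrite -{1}(expn1 T) ltn_exp2l //; lia.
have Tln : (T < n)%N by apply: leq_trans Tn.
have n4 : (4 <= n)%N by lia.
have n1 : (1 < n)%N by lia.
have T1 : (1 < T)%N by lia.
set K : R := (size Qs)%:R.
have K_ge : T%:R / 4 <= (K + t%:R) * t%:R ^+ 2.
  have T4 : (4 <= T)%N by lia.
  apply: le_trans (psi_ge T4) _.
  have T2t : (T <= 2 ^ t)%N by apply: leq_trans nt; apply: ltnW.
  apply: le_trans (sum_vonMangoldt_le_primes lgM lg_mono lg0 lg2 T2t) _.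
  rewrite ler_wpM2r ?sqr_ge0 //.
  rewrite (bigID (fun p : 'I_T => (p %| n)%N)) /= addrC; apply: lerD.
    rewrite /K /Qs size_filter -sum1_count natr_sum.
    by rewrite -[T in iota 0 T]subn0 -/(index_iota 0 T) big_mkord.
  by apply: (num_prime_divisors_le lgM lg_mono lg0 lg2); rewrite nt andbT; lia.
have K_le : K <= T%:R.
  by rewrite ler_nat size_filter; apply: leq_trans (count_size _ _) _; rewrite size_iota.
(* t is even, so that 2 ^ (t / 2) bounds the square root of n. *)
have t_half : t = ((10 * s.+1).*2)%N by rewrite /t -mul2n mulnA.
have nonprime_le : \sum_(e < n | ~~ prime e) Lam e <= (2 * T%:R) ^+ 10 * t%:R ^+ 2.
  have nt' : (n <= 2 ^ (10 * s.+1).*2)%N by rewrite -t_half.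
  have := sum_vonMangoldt_nonprime lgM lg_mono lg0 lg2 nt'; rewrite -t_half.
  have -> : (2 ^ (10 * s.+1) = (2 * T) ^ 10)%N by rewrite /T -expnS -expnM mulnC.
  by rewrite natrX natrM.
pose V := (T ^ 10)%N.
pose E := (n %/ V.+1)%N.
have V0 : (0 < V)%N by rewrite expn_gt0; lia.
have EVn : (E * V.+1 <= n)%N by apply: leq_trunc_div.
have En : (E < n)%N by apply: ltn_Pdiv; lia.
have := vaughan lgM lg_mono lg0 (cut_weight0 R Qs_prime Qs_ndvd) (cut_weight_ge R (n:=n) Qs) (T ^ 2) n1 V0.
rewrite -/E; move/(numeric_contradiction (K := K) (x := T%:R) (t := t%:R) (N := n%:R)
  (E := E%:R)); apply.
- by rewrite ler_nat.
- by rewrite -natrX ler_nat.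
- by rewrite -natrX ler_nat.
- by [].
- by [].
- by [].
- by [].
- rewrite -natrX -natrM ler_nat; apply: leq_trans EVn; by rewrite leq_mul.
- exact: (main_term_le Qs_prime Qs_le nt no n4 Tln nonprime_le).
- have := type_I_log_sum_le Qs_prime Qs_ndvd Qs_le n1 nt V.
  by rewrite -natr1 natrX.
- have := type_I_small_le Qs_prime Qs_ndvd Qs_le n1 nt (T ^ 2) V.
  by rewrite -[V.+1%:R]natr1 -[(T ^ 2).+1%:R]natr1 !natrX.
have ET2 : (E * T ^ 2 <= n)%N.
  by apply: leq_trans EVn; rewrite leq_mul // leqW // leq_exp2l.
have lam_bd e : (e < n)%N -> 0 <= Lam e <= t%:R.
  move=> en; rewrite Lam_ge0 /=; apply: le_trans (Lam_le _) _.
  by apply: (lg_le_t nt); apply: ltnW.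
apply: le_trans (bilinear_le Qs_uniq Qs_prime Qs_ndvd Qs_le (g := moebius_upto R V) V
  _ T1 ET2 lam_bd (moebius_upto_norm_le R V)) _; first by lia.
have hn : harmonic_sum R n <= t%:R by apply: harmonic_pow2_le.
have hE : harmonic_sum R E.+1 <= t%:R by apply: harmonic_pow2_le; apply: leq_trans nt.
have c0 : 0 <= 16 * K ^+ 2 * T%:R ^+ 8 * n%:R * E%:R by rewrite !mulr_ge0 ?exprn_ge0.
have d0 : 0 <= 100 * K * n%:R ^+ 2 by rewrite !mulr_ge0 ?exprn_ge0.
apply: ler_pM.
- by rewrite exprn_ge0 // harmonic_ge0.
- by rewrite mulr_ge0 ?sqr_ge0 // addr_ge0 // mulr_ge0 // harmonic_ge0.
- by rewrite lerXn2r ?nnegrE ?harmonic_ge0.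
by rewrite ler_wpM2l ?sqr_ge0 // lerD2l ler_wpM2l.
Qed.
End Final.

(** * Choice of the parameters *)

(** With x = s / (2 k), rounded down, c s.+1 is at most 2 ^ x * 2 ^ x. *)
Lemma polynomial_le_exp2 c k : (0 < k)%N ->
  exists s0, forall s, (s0 <= s)%N -> ((c * s.+1) ^ k <= 2 ^ s)%N.
Proof.
move=> k0; exists (k.*2 * (c * k.*2))%N => s ss; set x := (s %/ k.*2)%N.
have k20 : (0 < k.*2)%N by rewrite double_gt0.
have xs : (k.*2 * x <= s)%N by rewrite mulnC leq_trunc_div.
have cx : (c * k.*2 <= 2 ^ x)%N.
  by apply: leq_trans (ltnW (ltn_expl x (ltnSn 1))); rewrite leq_divRL // mulnC.
have sx : (s.+1 <= k.*2 * 2 ^ x)%N.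
  apply: (@leq_trans (k.*2 * x.+1)); last by rewrite leq_mul2l ltn_expl ?orbT.
  by rewrite mulnC -ltn_divLR.
apply: leq_trans (_ : ((2 ^ x * 2 ^ x) ^ k <= _)%N).
  rewrite leq_exp2r //; apply: (leq_trans (leq_mul (leqnn c) sx)).
  by rewrite mulnA leq_mul.
by rewrite -expnD -expnM leq_exp2l // addnn -doubleMl doubleMr mulnC.
Qed.

Lemma exists_binary_log (R : realType) : exists lg : nat -> R,
  [/\ forall a b, (0 < a)%N -> (0 < b)%N -> lg (a * b)%N = lg a + lg b,
      {homo lg : x y / (x <= y)%N >-> x <= y}, lg 0%N = 0 & lg 2%N = 1].
Proof.
have l2 : 0 < ln (2 : R) by rewrite ln_gt0 // ltr1n.
exists (fun a => ln a%:R / ln 2); split.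
- by move=> a b a0 b0; rewrite natrM lnM ?posrE ?ltr0n // mulrDl.
- move=> a b ab; rewrite ler_wpM2r ?invr_ge0 ?(ltW l2) //.
  have [->|a0] := posnP a; last by rewrite ler_ln ?posrE ?ltr0n ?(leq_trans a0) // ler_nat.
  rewrite ln0 //; have [->|b0] := posnP b; first by rewrite ln0.
  by rewrite ln_ge0 // ler1n.
- by rewrite ln0 // mul0r.
- by rewrite divff // gt_eqF.
Qed.

Local Close Scope ring_scope.

Theorem theorem1p1 :
  exists N : nat, forall n : nat, N <= n ->
    exists p m : nat, [/\ prime p, 0 < m, ~ squarefree m & n = p + m].
Proof.
have [lg [lgM lg_mono lg0 lg2]] := exists_binary_log Rdefinitions.R.
have [s0 s0P] := polynomial_le_exp2 20 (ltn0Sn 12).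
exists (2 ^ (20 * s0)) => n nN.
have n0 : 0 < n by apply: leq_trans nN; rewrite expn_gt0.
(* T = 2 ^ s is the largest power of two with T ^ 20 <= n. *)
pose s := trunc_log 2 n %/ 20.
have ss : s0 <= s by rewrite leq_divRL // mulnC trunc_log_max.
have Tn : (2 ^ s) ^ 20 <= n.
  rewrite -expnM; apply: leq_trans (trunc_logP (ltnSn 1) n0).
  by rewrite leq_exp2l // leq_trunc_div.
have nt : n <= 2 ^ (20 * s.+1).
  apply: ltnW; apply: leq_trans (trunc_log_ltn n (ltnSn 1)) _.
  by rewrite leq_exp2l // mulnC -ltn_divLR.
have [p [q [pp pn qp qnp]]] := exists_prime_square_shift lgM lg_mono lg0 lg2 (s0P s ss) Tn nt.
exists p, (n - p); split=> //; first by rewrite subn_gt0.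
  by apply/not_squarefreeP; [rewrite subn_gt0 | exists q].
by rewrite subnKC // ltnW.
Qed.
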